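(* Let $\delta>0$. Then for all $u,v\in\mathcal U_\delta(d)$, $$\mathrm d_{\mathrm D}(u,v)\leq d\,\delta^{-1}\,\mathrm d_{\mathrm{mr}}(u,v).$$
   Context: Fix $d\in\mathbb N$. All unitary tuples act on separable Hilbert spaces. For $d$-tuples of unitaries $u=(u_1,\dots,u_d)$, $v=(v_1,\dots,v_d)$ write $u\sim v$ if there is a $*$-isomorphism $\pi\colon C^*(u)\to C^*(v)$ with $\pi(u_i)=v_i$ for all $i$ (here $C^*(u)$ is the C*-algebra generated by $u_1,\dots,u_d$). $\mathcal U(d)$ is the set of $\sim$-equivalence classes of $d$-tuples of unitaries; tuples are identified with their classes. For unitary tuples $u,v$ and $c>0$, write $u\prec cv$ if there exist Hilbert spaces $H\subseteq K$ and tuples $U\in B(H)^d$, $V\in B(K)^d$ with $U\sim u$, $V\sim v$ and $U_i=P_H\,cV_i|_H$ for all $i$, where $P_H$ is the orthogonal projection of $K$ onto $H$. Put $c(u,v)=\inf\{c: u\prec cv\}$ (with $\inf\emptyset=+\infty$). The matrix range of $A\in B(H)^d$ is $\mathcal W(A)=\bigcup_n\mathcal W_n(A)$ (disjoint union), where $\mathcal W_n(A)=\{(\phi(A_1),\dots,\phi(A_d)) : \phi\colon B(H)\to M_n(\mathbb C) \text{ unital completely positive}\}\subseteq M_n(\mathbb C)^d$; it depends only on the $\sim$-class of a unitary tuple. For matrix ranges, $\mathrm d_{\mathrm H}(\mathcal W(u),\mathcal W(v))=\sup_n \mathrm d_{\mathrm H}(\mathcal W_n(u),\mathcal W_n(v))$,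 where on the right $\mathrm d_{\mathrm H}$ is the Hausdorff distance with respect to the norm $\|X\|=\max_i\|X_i\|$ on $M_n(\mathbb C)^d$. Define $$\mathrm d_{\mathrm D}(u,v)=\log\max\{c(u,v),c(v,u)\},\qquad \mathrm d_{\mathrm{mr}}(u,v)=\mathrm d_{\mathrm H}(\mathcal W(u),\mathcal W(v)).$$ For $\delta>0$, $\mathcal U_\delta(d)$ is the set of $u\in\mathcal U(d)$ with $\mathcal W_1(u)\supseteq\{z\in\mathbb C^d:\|z\|<\delta\}$ ($\|\cdot\|$ the Euclidean norm). *)

(* Defs.v *)
From HB Require Import structures.
From mathcomp Require Import all_boot all_order all_algebra.
From mathcomp Require Import complex.
From mathcomp Require Import all_classical all_reals all_analysis.

Set Implicit Arguments.
Unset Strict Implicit.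
Unset Printing Implicit Defensive.

Import Order.TTheory GRing.Theory Num.Theory.
Import numFieldNormedType.Exports.

Local Open Scope classical_set_scope.
Local Open Scope complex_scope.
Local Open Scope ring_scope.

(* The form is linear in its first argument and conjugate-linear in the second
   one; positive definiteness is part of the library structure {dot _ for _}.
   The norm of a normedModType over R[i] takes its (real) values in R[i], hence
   the projections [complex.Re `|_|] below. The zero space is allowed. *)
Record hilbertType (R : realType) := HilbertType {
  hilbert_sort :> completeNormedModType R[i];
  hdot : {dot hilbert_sort for @Num.conj R[i]};
  hdot_norm : forall x, hdot x x = `|x| ^+ 2 }.

Definition separable (T : topologicalType) :=
  exists2 D : set T, countable D & dense D.

Section BoundedOperators.
Variables (R : realType) (H K : hilbertType R).

Definition bounded_linear : {pred H -> K} :=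
  [pred f | `[< linear f /\ exists M : R[i], forall x, `|f x| <= M * `|x| >]].

Record bop := Bop { bop_fun :> H -> K; _ : bop_fun \in bounded_linear }.

HB.instance Definition _ := [isSub of bop for bop_fun].
HB.instance Definition _ := [Choice of bop by <:].

Lemma bounded_linear_submod_closed : submod_closed bounded_linear.
Proof.
split=> [|a f g].
  apply/asboolP; split; first by move=> b x y; rewrite /= scaler0 addr0.
  by exists 0 => x; rewrite normr0 mul0r.
move=> /asboolP[fl [M fM]] /asboolP[gl [N gN]]; apply/asboolP; split.
  move=> b x y; rewrite !fctE fl gl !scalerDr !scalerA (mulrC a b) !addrA.
  by congr (_ + _); rewrite -!addrA; congr (_ + _); rewrite addrC.
exists (`|a| * M + N) => x; rewrite !fctE (le_trans (ler_normD _ _))//.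
by rewrite mulrDl lerD// normrZ -mulrA ler_wpM2l.
Qed.

HB.instance Definition _ :=
  GRing.isSubmodClosed.Build R[i] (H -> K) bounded_linear
    bounded_linear_submod_closed.
HB.instance Definition _ := [SubChoice_isSubLmodule of bop by <:].

Lemma bop_linear (T : bop) : linear T.
Proof. by case: T => f /= /asboolP[]. Qed.

HB.instance Definition _ (T : bop) :=
  GRing.isLinear.Build R[i] H K *:%R T (bop_linear T).

Lemma bop_bounded (T : bop) :
  exists2 M : R[i], 0 <= M & forall x, `|T x| <= M * `|x|.
Proof.
case: T => f /= /asboolP[_ [M fM]].
have [[y /eqP y0]|nz] := pselect (exists y : H, y <> 0).
  exists M => //; rewrite -(@pmulr_lge0 _ `|y|) ?normr_gt0//.
  exact: le_trans (fM y).
exists 0 => // x; rewrite mul0r (le_trans (fM x))//.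
have -> : x = 0 by apply: contrapT => x0; apply: nz; exists x.
by rewrite normr0 mulr0.
Qed.

Definition opnorm (T : bop) : \bar R :=
  ereal_sup [set (complex.Re `|T x|)%:E | x in [set x | `|x| <= 1]].

End BoundedOperators.

Arguments bounded_linear {R} H K.

Section Composition.
Variable R : realType.

Lemma bid_subproof (H : hilbertType R) : @idfun H \in bounded_linear H H.
Proof. by apply/asboolP; split=> //; exists 1 => x; rewrite mul1r. Qed.

Definition bid (H : hilbertType R) : bop H H := Bop (bid_subproof H).

Lemma bcomp_subproof (H K L : hilbertType R) (S : bop K L) (T : bop H K) :
  S \o T \in bounded_linear H L.
Proof.
apply/asboolP; split; first by move=> a x y; rewrite /= !linearP.
have [M M0 SM] := bop_bounded S; have [N _ TN] := bop_bounded T.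
by exists (M * N) => x /=; rewrite (le_trans (SM _))// -mulrA ler_wpM2l.
Qed.

Definition bcomp (H K L : hilbertType R) (S : bop K L) (T : bop H K) :
  bop H L := Bop (bcomp_subproof S T).

(* Adjoints of bounded operators always exist and are unique; a relation avoids
   depending on the Riesz representation theorem, which the library lacks. *)
Definition is_adjoint (H K : hilbertType R) (T : bop H K) (S : bop K H) :=
  forall x y, hdot K (T x) y = hdot H x (S y).

Definition unitary_op (H : hilbertType R) (T : bop H H) :=
  exists S, [/\ is_adjoint T S, bcomp S T = bid H & bcomp T S = bid H].

End Composition.

(* Elements are representatives of the *-isomorphism classes of tuples. *)
Record unitaries (R : realType) (d : nat) := Unitaries {
  uspace : hilbertType R;
  uspace_separable : separable uspace;
  uop :> 'I_d -> bop uspace uspace;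
  uop_unitary : forall i, unitary_op (uop i) }.

Section GeneratedAlgebra.
Variable R : realType.

Definition cstar_subalgebra (H : hilbertType R) (A : set (bop H H)) :=
  [/\ A 0 /\ (forall S T, A S -> A T -> A (S + T)),
      forall (a : R[i]) S, A S -> A (a *: S),
      forall S T, A S -> A T -> A (bcomp S T),
      forall S T, A S -> is_adjoint S T -> A T &
      forall T, (forall e : R, 0 < e ->
        exists2 S, A S & (opnorm (T - S)%R < e%:E)%E) -> A T].

Definition cstar_generated d (u : unitaries R d) :
    set (bop (uspace u) (uspace u)) :=
  smallest (@cstar_subalgebra (uspace u)) (range u).
Arguments cstar_generated {d} u.

(* A *-isomorphism of the generated algebras is represented by a total function
   on the bounded operators, constrained on the generated algebra only. *)
Definition uequiv d (u v : unitaries R d) :=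
  exists pi : bop (uspace u) (uspace u) -> bop (uspace v) (uspace v),
  [/\ set_bij (cstar_generated u) (cstar_generated v) pi,
      {in cstar_generated u &, forall S T, pi (S + T) = pi S + pi T} /\
      (forall a : R[i], {in cstar_generated u, forall S, pi (a *: S) = a *: pi S}),
      {in cstar_generated u &, forall S T,
        pi (bcomp S T) = bcomp (pi S) (pi T)},
      {in cstar_generated u, forall S T,
        is_adjoint S T -> is_adjoint (pi S) (pi T)} &
      forall i, pi (u i) = v i].

End GeneratedAlgebra.

Section Dilation.
Variable R : realType.

Definition orthogonal_projection (K : hilbertType R) (A : set K) (P : K -> K) :=
  forall k, A (P k) /\ forall a, A a -> hdot K (k - P k) a = 0.

(* The inclusion of Hilbert spaces is given by an isometric embedding J. *)
Definition dilates d (c : R) (u v : unitaries R d) :=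
  exists U V : unitaries R d, [/\ uequiv U u, uequiv V v &
    exists (J : bop (uspace U) (uspace V)) (P : uspace V -> uspace V),
    [/\ forall x y, hdot (uspace V) (J x) (J y) = hdot (uspace U) x y,
        orthogonal_projection (range J) P &
        forall i x, J (U i x) = P (c%:C *: V i (J x))]].

(* The infimum of the empty set is +oo. *)
Definition dilation_constant d (u v : unitaries R d) : \bar R :=
  ereal_inf [set c%:E | c in [set c : R | 0 < c /\ dilates c u v]].

Definition dD d (u v : unitaries R d) : \bar R :=
  lne (maxe (dilation_constant u v) (dilation_constant v u)).

End Dilation.

Section MatrixRange.
Variable R : realType.

(* [T i j] is viewed as an operator on the m-fold direct sum of H. *)
Definition positive_opmx (H : hilbertType R) m (T : 'I_m -> 'I_m -> bop H H) :=
  forall x : 'I_m -> H, 0 <= \sum_i \sum_j hdot H (T i j (x j)) (x i).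

(* [X i j] is viewed as an operator on the m-fold direct sum of C^n. *)
Definition positive_mxmx n m (X : 'I_m -> 'I_m -> 'M[R[i]]_n) :=
  forall x : 'I_m -> 'cV[R[i]]_n,
  0 <= \sum_i \sum_j ((map_mx Num.conj (x i))^T *m X i j *m x j) 0 0.

Definition ucp (H : hilbertType R) n (phi : {linear bop H H -> 'M[R[i]]_n}) :=
  phi (bid H) = 1%:M /\
  forall m (T : 'I_m -> 'I_m -> bop H H), positive_opmx T ->
    positive_mxmx (fun i j => phi (T i j)).

Definition matrix_range n d (u : unitaries R d) : set ('I_d -> 'M[R[i]]_n) :=
  [set X | exists2 phi : {linear bop (uspace u) (uspace u) -> 'M[R[i]]_n},
             ucp phi & forall i, X i = phi (u i)].
Arguments matrix_range n {d} u.

Definition l2norm n (z : 'cV[R[i]]_n) : R :=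
  Num.sqrt (\sum_i (complex.Re `|z i 0|) ^+ 2).

(* The library norm on matrices is the entrywise one. *)
Definition mxopnorm n (X : 'M[R[i]]_n) : \bar R :=
  ereal_sup [set (l2norm (X *m z))%:E | z in [set z | l2norm z <= 1]].

Definition mxtuple_dist n d (X Y : 'I_d -> 'M[R[i]]_n) : \bar R :=
  \big[maxe/0%E]_i mxopnorm (X i - Y i).

Definition hausdorff_dist (T : Type) (rho : T -> T -> \bar R) (A B : set T) :=
  maxe (ereal_sup [set ereal_inf [set rho x y | y in B] | x in A])
       (ereal_sup [set ereal_inf [set rho x y | x in A] | y in B]).

Definition dmr d (u v : unitaries R d) : \bar R :=
  ereal_sup [set hausdorff_dist (@mxtuple_dist n d)
                   (matrix_range n u) (matrix_range n v)
            | n in [set n | (0 < n)%N]].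

(* C^d is identified with the d-tuples of 1 x 1 matrices. *)
Definition Udelta d (delta : R) (u : unitaries R d) : Prop :=
  forall z : 'cV[R[i]]_d, l2norm z < delta ->
    matrix_range 1 u (fun i => (z i 0)%:M).

End MatrixRange.

(* Main.v *)
(* Let r exceed the matrix range distance and let c = 1 + d r / delta. Since the
   first matrix range of v contains the delta-ball, matrix convexity shows that
   each level of the matrix range of v contains every tuple Z with
   d |Z_i| < delta for all i: a strict contraction is a combination sum_k lam_k P_k
   with |lam_k| <= 1, P_k >= 0 and sum_k P_k = 1. Writing
   X = Y + (X - Y) with Y in W(v) close to X in W(u) gives W(u) <= c W(v).

   To dilate u to c v, compress u to the span of the first n vectors of an
   orthonormal basis (e_k). The compression is c Phi_n(v) for a unital completely
   positive Phi_n. The Stinespring forms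
   <S (x) x, T (x) y>_n = <Phi_n(T^* S) x, y> on B(H_v) (x) H_u have an
   ultralimit, and completing it together with a copy of H_v (which makes the
   resulting representation of C*(v) faithful) yields a tuple V ~ v and the
   isometry x |-> 1 (x) x compressing c V to u. The completion is taken to be
   the space of bounded antilinear functionals, which is complete at once. *)
From HB Require Import structures.
Require Import Defs.
From mathcomp Require Import all_boot all_order all_algebra.
From mathcomp Require Import complex ring lra.
From mathcomp Require Import all_classical all_reals all_analysis.

Set Implicit Arguments.
Unset Strict Implicit.
Unset Printing Implicit Defensive.

Import Order.TTheory GRing.Theory Num.Theory.
Import numFieldNormedType.Exports.

Local Open Scope classical_set_scope.
Local Open Scope complex_scope.
Local Open Scope ring_scope.

Section RealNorm.
Variable R : realType.
Implicit Types (z w : R[i]).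

Lemma conjcE z : Num.conj z = conjc z.
Proof. by []. Qed.

Lemma Re_conj z : complex.Re (Num.conj z) = complex.Re z.
Proof. by case: z. Qed.

Lemma Im_conj z : complex.Im (Num.conj z) = - complex.Im z.
Proof. by case: z. Qed.

Lemma ReD z w : complex.Re (z + w) = complex.Re z + complex.Re w.
Proof. by case: z w => ? ? [? ?]. Qed.

Lemma ImD z w : complex.Im (z + w) = complex.Im z + complex.Im w.
Proof. by case: z w => ? ? [? ?]. Qed.

Lemma ReN z : complex.Re (- z) = - complex.Re z.
Proof. by case: z. Qed.

Lemma ImN z : complex.Im (- z) = - complex.Im z.
Proof. by case: z. Qed.

Lemma ReM z w :
  complex.Re (z * w) = complex.Re z * complex.Re w - complex.Im z * complex.Im w.
Proof. by case: z w => ? ? [? ?]. Qed.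

Lemma ImM z w :
  complex.Im (z * w) = complex.Re z * complex.Im w + complex.Im z * complex.Re w.
Proof. by case: z w => ? ? [? ?]. Qed.

Lemma Re_sum (I : Type) (r : seq I) (P : pred I) (F : I -> R[i]) :
  complex.Re (\sum_(i <- r | P i) F i) = \sum_(i <- r | P i) complex.Re (F i).
Proof. by apply: (big_morph _ ReD). Qed.

Lemma complex_eq z w :
  complex.Re z = complex.Re w -> complex.Im z = complex.Im w -> z = w.
Proof. by case: z w => ? ? [? ?] /= -> ->. Qed.

Lemma ge0_ReC z : 0 <= z -> z = (complex.Re z)%:C.
Proof. by move=> /ger0_real /RRe_real ->. Qed.

Lemma ge0_Re z : 0 <= z -> 0 <= complex.Re z.
Proof. by move=> z0; rewrite -ler0c -ge0_ReC. Qed.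

Definition rnorm {V : normedZmodType R[i]} (x : V) : R := complex.Re `|x|.

Section Normed.
Variable V : normedZmodType R[i].
Implicit Types x y : V.

Lemma rnormE x : `|x| = (rnorm x)%:C.
Proof. by rewrite /rnorm -ge0_ReC. Qed.

Lemma rnorm_ge0 x : 0 <= rnorm x.
Proof. by rewrite -ler0c -rnormE. Qed.

Lemma rnorm0 : rnorm (0 : V) = 0.
Proof. by rewrite /rnorm normr0. Qed.

Lemma rnorm0_eq0 x : rnorm x = 0 -> x = 0.
Proof. by move=> x0; apply/eqP; rewrite -normr_eq0 rnormE x0. Qed.

Lemma rnormD x y : rnorm (x + y) <= rnorm x + rnorm y.
Proof. by rewrite -lecR rmorphD /= -!rnormE ler_normD. Qed.

Lemma rnormN x : rnorm (- x) = rnorm x.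
Proof. by rewrite /rnorm normrN. Qed.

Lemma rnormB x y : rnorm (x - y) <= rnorm x + rnorm y.
Proof. by rewrite -(rnormN y) rnormD. Qed.

Lemma rnorm_distC x y : rnorm (x - y) = rnorm (y - x).
Proof. by rewrite /rnorm distrC. Qed.

Lemma rnorm_dist x y (z : V) : rnorm (x - y) <= rnorm (x - z) + rnorm (z - y).
Proof. by rewrite -[x - y](subrKA z) rnormD. Qed.

Lemma le_rnorm_norm x (e : R) : (rnorm x <= e) = (`|x| <= e%:C).
Proof. by rewrite rnormE lecR. Qed.

Lemma lt_rnorm_norm x (e : R) : (rnorm x < e) = (`|x| < e%:C).
Proof. by rewrite rnormE ltcR. Qed.

Lemma rnorm_eps x (M : R) : (forall e, 0 < e -> rnorm x <= M * e) -> x = 0.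
Proof.
move=> xM; apply: rnorm0_eq0; apply/eqP; rewrite eq_le rnorm_ge0 andbT.
apply/ler_addgt0Pr => e e0; rewrite add0r.
have := xM (e / (`|M| + 1)); rewrite divr_gt0 ?ltr_wpDl// => /(_ isT)/le_trans.
apply; rewrite mulrCA -{2}(mulr1 e) ler_wpM2l ?(ltW e0)//.
by rewrite ler_pdivrMr ?ltr_wpDl// mul1r (le_trans (ler_norm _))// lerDl.
Qed.

End Normed.

Lemma rnormZ (V : normedModType R[i]) (a : R[i]) (x : V) :
  rnorm (a *: x) = rnorm a * rnorm x.
Proof. by apply: complexI; rewrite rmorphM /= -!rnormE normrZ. Qed.

Lemma rnormM z w : rnorm (z * w) = rnorm z * rnorm w.
Proof. by apply: complexI; rewrite rmorphM /= -!rnormE normrM. Qed.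

Lemma rnormC (k : R) : rnorm k%:C = `|k|.
Proof. by rewrite /rnorm normc_def /= expr0n addr0 sqrtr_sqr. Qed.

Lemma rnorm1 : rnorm (1 : R[i]) = 1.
Proof. by rewrite /rnorm normr1. Qed.

Lemma rnorm_conj z : rnorm (Num.conj z) = rnorm z.
Proof. by rewrite /rnorm conjcE normcJ. Qed.

Lemma rnorm_sqr z : rnorm z ^+ 2 = complex.Re z ^+ 2 + complex.Im z ^+ 2.
Proof. by apply: complexI; rewrite add_Re2_Im2 rnormE rmorphXn. Qed.

Lemma mulcJ z : z * Num.conj z = (rnorm z ^+ 2)%:C.
Proof. by rewrite conjcE -sqr_normc rnormE rmorphXn. Qed.

Lemma normr_Re_le z : `|complex.Re z| <= rnorm z.
Proof. by rewrite -lecR (le_trans (normc_ge_Re _))// rnormE. Qed.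

Lemma Re_le_rnorm z : complex.Re z <= rnorm z.
Proof. by rewrite (le_trans (ler_norm _)) ?normr_Re_le. Qed.

Lemma rnorm_le_ReIm z : rnorm z <= `|complex.Re z| + `|complex.Im z|.
Proof.
rewrite -(@ler_pXn2r _ 2) ?nnegrE ?rnorm_ge0 ?addr_ge0// rnorm_sqr.
rewrite sqrrD !real_normK ?num_real// lerD2r lerDl mulrn_wge0 ?mulr_ge0//.
Qed.

Lemma normr_Im_le z : `|complex.Im z| <= rnorm z.
Proof.
rewrite -(@ler_pXn2r _ 2) ?nnegrE ?rnorm_ge0// rnorm_sqr real_normK ?num_real//.
by rewrite lerDr sqr_ge0.
Qed.

Lemma cauchy_filter_cvg (T : Type) (F : set_system T) (FF : ProperFilter F)
    (h : T -> R[i]) :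
  (forall e : R, 0 < e -> exists2 A, F A &
     forall s t, A s -> A t -> rnorm (h s - h t) <= e) ->
  exists l, forall e : R, 0 < e -> F [set t | rnorm (h t - l) <= e].
Proof.
move=> hF.
have cauchyR (g : T -> R) : (forall s t, `|g s - g t| <= rnorm (h s - h t)) ->
    exists l : R, forall e : R, 0 < e -> F [set t | `|g t - l| <= e].
  move=> gh; have /cvg_ex[l gl] : cvg (g @ F).
    apply: R_complete; apply/cauchy_exP => e e0.
    have [A FA Ae] := hF (e / 2) (divr_gt0 e0 (ltr0Sn _ 1)).
    have [s As] := filter_ex FA; exists (g s).
    suff : F (g @^-1` ball (g s) e) by [].
    apply: filterS FA => t At.
    apply: le_lt_trans (gh _ _) (le_lt_trans (Ae _ _ As At) _).
    by rewrite gtr_pMr// invf_lt1// ltr1n.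
  exists l => e e0; move/cvgrPdist_le : gl => /(_ e e0).
  by apply: filterS => t /=; rewrite distrC.
have [a ah] : exists l : R, forall e : R, 0 < e ->
    F [set t | `|complex.Re (h t) - l| <= e].
  by apply: cauchyR => s t; rewrite -ReN -ReD normr_Re_le.
have [b bh] : exists l : R, forall e : R, 0 < e ->
    F [set t | `|complex.Im (h t) - l| <= e].
  by apply: cauchyR => s t; rewrite -ImN -ImD normr_Im_le.
exists (a +i* b) => e e0; have e2 : 0 < e / 2 by rewrite divr_gt0.
apply: filterS (filterI (ah _ e2) (bh _ e2)) => t [ta tb] /=.
rewrite (le_trans (rnorm_le_ReIm _))// ReD ReN ImD ImN /=.
by rewrite [leRHS](splitr e) lerD.
Qed.

Lemma cauchy_seq_cvg (h : nat -> R[i]) (r : nat -> R) :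
  (forall e, 0 < e -> exists N, forall n, (N <= n)%N -> r n <= e) ->
  (forall m n, rnorm (h m - h n) <= r m + r n) ->
  exists l, forall n, rnorm (h n - l) <= r n.
Proof.
move=> r0 hr.
have [|l hl] := @cauchy_filter_cvg nat \oo _ h.
  move=> e e0; have [N Ne] := r0 (e / 2) (divr_gt0 e0 (ltr0Sn _ 1)).
  exists [set n | (N <= n)%N]; first exact: nbhs_infty_ge.
  by move=> s t /= Ns Nt; rewrite (le_trans (hr _ _))// (splitr e) lerD// Ne.
exists l => n; apply/ler_addgt0Pr => e e0.
have e2 : 0 < e / 2 by rewrite divr_gt0.
have [N Ne] := r0 _ e2.
have [m [/= ml Nm]] := filter_ex (filterI (hl _ e2) (nbhs_infty_ge N)).
rewrite (le_trans (rnorm_dist _ _ (h m)))//.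
rewrite (le_trans (lerD (hr _ _) ml))// -addrA lerD2l.
by rewrite [leRHS](splitr e) lerD2r Ne.
Qed.

End RealNorm.

Lemma invn_small (R : realType) (C e : R) : 0 <= C -> 0 < e ->
  exists N, forall n, (N <= n)%N -> C * n.+1%:R^-1 <= e.
Proof.
move=> C0 e0; exists (Num.bound (C / e)) => n Nn.
rewrite ler_pdivrMr// -ler_pdivrMl// mulrC.
have /ltW/le_trans := archi_boundP (divr_ge0 C0 (ltW e0)).
by apply; rewrite ler_nat ltnW.
Qed.

Lemma quadratic_discriminant (R : realFieldType) (a b w : R) :
  0 <= a -> 0 <= b -> 0 <= w ->
  (forall s, 0 <= a - 2 * s * w + s ^+ 2 * w * b) -> w <= a * b.
Proof.
move=> a0 b0 w0 h; have [->|wN] := eqVneq w 0; first exact: mulr_ge0.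
have [b0'|bN] := eqVneq b 0.
  have := h ((a + 1) / w); rewrite b0' !mulr0 addr0 -mulrA divfK//; lra.
have bp : 0 < b by rewrite lt_neqAle eq_sym bN.
rewrite -ler_pdivrMr// mulrC.
have := h b^-1; have -> : b^-1 ^+ 2 * w * b = b^-1 * w by field.
by rewrite -mulrA; lra.
Qed.

Section Semidot.
Variables (R : realType) (E : lmodType R[i]).

Record semidot := Semidot {
  sdot :> E -> E -> R[i];
  sdotP : forall a x y z, sdot (a *: x + y) z = a * sdot x z + sdot y z;
  sdotC : forall x y, sdot y x = Num.conj (sdot x y);
  sdotxx_ge0 : forall x, 0 <= sdot x x }.

(* Over the complex numbers, positivity of a sesquilinear form implies its
   symmetry, by polarization. *)
Lemma positive_sesquilinear_sym (f : E -> E -> R[i]) :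
  (forall a x y z, f (a *: x + y) z = a * f x z + f y z) ->
  (forall a x y z, f z (a *: x + y) = Num.conj a * f z x + f z y) ->
  (forall x, 0 <= f x x) -> forall x y, f y x = Num.conj (f x y).
Proof.
move=> fl fr f0 x y.
have Im0 z : complex.Im (f z z) = 0 by apply: ger0_Im.
have h1 := Im0 (1 *: x + y); have h2 := Im0 ('i%C *: x + y).
move: h1 h2; rewrite !fl !fr !(ImD, ImM, ReD, ReM, Re_conj, Im_conj) /=.
rewrite !Im0 => h1 h2.
by apply: complex_eq; rewrite ?Re_conj ?Im_conj; lra.
Qed.

Variable b : semidot.

Lemma sdotDl x y z : b (x + y) z = b x z + b y z.
Proof. by rewrite -{1}[x]scale1r sdotP mul1r. Qed.

Lemma sdot0l z : b 0 z = 0.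
Proof. by apply: (addIr (b 0 z)); rewrite -sdotDl !add0r. Qed.

Lemma sdotZl a x z : b (a *: x) z = a * b x z.
Proof. by rewrite -[a *: x]addr0 sdotP sdot0l addr0. Qed.

Lemma sdotNl x z : b (- x) z = - b x z.
Proof. by rewrite -scaleN1r sdotZl mulN1r. Qed.

Lemma sdotBl x y z : b (x - y) z = b x z - b y z.
Proof. by rewrite sdotDl sdotNl. Qed.

Lemma sdotDr x y z : b z (x + y) = b z x + b z y.
Proof. by rewrite !(sdotC b _ z) sdotDl rmorphD. Qed.

Lemma sdot0r z : b z 0 = 0.
Proof. by rewrite (sdotC b) sdot0l rmorph0. Qed.

Lemma sdotZr a x z : b z (a *: x) = Num.conj a * b z x.
Proof. by rewrite !(sdotC b _ z) sdotZl rmorphM. Qed.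

Lemma sdotNr x z : b z (- x) = - b z x.
Proof. by rewrite -scaleN1r sdotZr rmorphN1 mulN1r. Qed.

Lemma sdotBr x y z : b z (x - y) = b z x - b z y.
Proof. by rewrite sdotDr sdotNr. Qed.

Lemma sdot_suml (I : Type) (r : seq I) (P : pred I) (F : I -> E) z :
  b (\sum_(i <- r | P i) F i) z = \sum_(i <- r | P i) b (F i) z.
Proof. by elim/big_rec2: _ => [|i x y _ <-]; rewrite ?sdot0l ?sdotDl. Qed.

Lemma sdot_sumr (I : Type) (r : seq I) (P : pred I) (F : I -> E) z :
  b z (\sum_(i <- r | P i) F i) = \sum_(i <- r | P i) b z (F i).
Proof. by elim/big_rec2: _ => [|i x y _ <-]; rewrite ?sdot0r ?sdotDr. Qed.

Definition snorm x : R := Num.sqrt (complex.Re (b x x)).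

Lemma snorm_ge0 x : 0 <= snorm x.
Proof. exact: sqrtr_ge0. Qed.

Lemma snorm_sqr x : snorm x ^+ 2 = complex.Re (b x x).
Proof. by rewrite sqr_sqrtr// ge0_Re// sdotxx_ge0. Qed.

Lemma sdotxx x : b x x = (snorm x ^+ 2)%:C.
Proof. by rewrite snorm_sqr -ge0_ReC// sdotxx_ge0. Qed.

Lemma snorm_sqrD x y :
  snorm (x + y) ^+ 2 = snorm x ^+ 2 + 2 * complex.Re (b x y) + snorm y ^+ 2.
Proof.
rewrite !snorm_sqr sdotDl !sdotDr !ReD (sdotC b x y) Re_conj; ring.
Qed.

Lemma snorm_sqrZ a x : snorm (a *: x) ^+ 2 = rnorm a ^+ 2 * snorm x ^+ 2.
Proof.
by rewrite snorm_sqr sdotZl sdotZr mulrA mulcJ sdotxx -rmorphM.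
Qed.

Lemma snormZ a x : snorm (a *: x) = rnorm a * snorm x.
Proof.
apply/eqP; rewrite -(@eqrXn2 _ 2)// ?mulr_ge0 ?snorm_ge0 ?rnorm_ge0//.
by rewrite exprMn snorm_sqrZ.
Qed.

Lemma snorm0 : snorm 0 = 0.
Proof. by rewrite /snorm sdot0l sqrtr0. Qed.

Lemma snormN x : snorm (- x) = snorm x.
Proof. by rewrite /snorm sdotNl sdotNr opprK. Qed.

Lemma snorm_sqrD_scale (s : R) w x y :
  snorm (x + (s%:C * w) *: y) ^+ 2 =
    snorm x ^+ 2 + 2 * s * complex.Re (Num.conj w * b x y)
    + s ^+ 2 * rnorm w ^+ 2 * snorm y ^+ 2.
Proof.
rewrite snorm_sqrD snorm_sqrZ sdotZr rmorphM /= rnormM rnormC exprMn.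
rewrite real_normK ?num_real// -(mulrA _ (Num.conj w)).
rewrite (_ : Num.conj s%:C = s%:C); last by rewrite conjcE conjc_real.
by rewrite ReM /= mul0r subr0 mulrA.
Qed.

Lemma sdot_CauchySchwarz x y : rnorm (b x y) <= snorm x * snorm y.
Proof.
rewrite -(@ler_pXn2r _ 2) ?nnegrE ?mulr_ge0 ?snorm_ge0 ?rnorm_ge0// exprMn.
apply: quadratic_discriminant; rewrite ?sqr_ge0// => s.
have := sqr_ge0 (snorm (x + ((- s)%:C * b x y) *: y)).
rewrite snorm_sqrD_scale mulrC [Num.conj _ * _]mulrC mulcJ /=.
by rewrite sqrrN; congr (_ <= _); ring.
Qed.

Lemma snormD x y : snorm (x + y) <= snorm x + snorm y.
Proof.
rewrite -(@ler_pXn2r _ 2) ?nnegrE ?addr_ge0 ?snorm_ge0// snorm_sqrD sqrrD.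
rewrite lerD2r lerD2l -[leRHS]mulr_natl ler_wpM2l//.
by rewrite (le_trans (Re_le_rnorm _))// sdot_CauchySchwarz.
Qed.

Lemma snorm_dist x y z : snorm (x - y) <= snorm (x - z) + snorm (z - y).
Proof. by rewrite -[x - y](subrKA z) snormD. Qed.

Lemma snorm_sum (I : Type) (r : seq I) (P : pred I) (F : I -> E) :
  snorm (\sum_(i <- r | P i) F i) <= \sum_(i <- r | P i) snorm (F i).
Proof.
elim/big_rec2: _ => [|i y x _ h]; first by rewrite snorm0.
by rewrite (le_trans (snormD _ _))// lerD2l.
Qed.

Lemma snorm_le_dual z e : 0 <= e -> 
  (forall y, rnorm (b z y) <= e * snorm y) -> snorm z <= e.
Proof.
move=> e0 /(_ z); rewrite sdotxx rnormC normrX ger0_norm ?snorm_ge0// expr2.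
have [->//|z0] := eqVneq (snorm z) 0.
by rewrite ler_pM2r// lt_neqAle eq_sym z0 snorm_ge0.
Qed.

Definition antilinear (f : E -> R[i]) :=
  forall a x y, f (a *: x + y) = Num.conj a * f x + f y.

Lemma antilinear_sdot z : antilinear (b z).
Proof. by move=> a x y; rewrite sdotDr sdotZr. Qed.

(* [z] almost maximizes [2 Re f(y) - |y|^2]. *)
Lemma antilinear_approx (f : E -> R[i]) (M : R) : antilinear f ->
  (forall x, rnorm (f x) <= M * snorm x) ->
  forall e, 0 < e -> exists z, forall y, rnorm (f y - b z y) <= e * snorm y.
Proof.
move=> fl fM e e0; pose q y := 2 * complex.Re (f y) - snorm y ^+ 2.
have qM : has_sup (range q).
  split; first by exists (q 0), 0.
  exists (M ^+ 2) => _ [y _ <-]; rewrite /q.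
  have := le_trans (Re_le_rnorm _) (fM y); have := sqr_ge0 (M - snorm y).
  rewrite sqrrB; lra.
have e2 : 0 < e ^+ 2 by rewrite exprn_gt0.
have [_ [z _ <-] qz] := sup_adherent e2 qM.
exists z => y; rewrite -(@ler_pXn2r _ 2) ?nnegrE ?mulr_ge0 ?snorm_ge0 ?(ltW e0)//;
  rewrite ?rnorm_ge0 ?mulr_ge0 ?snorm_ge0 ?(ltW e0)//.
rewrite exprMn; apply: quadratic_discriminant; rewrite ?sqr_ge0// => s.
set w := f y - b z y.
have fD x1 x2 : f (x1 + x2) = f x1 + f x2.
  by rewrite -{1}[x1]scale1r fl rmorph1 mul1r.
have f0 : f 0 = 0 by apply: (addIr (f 0)); rewrite -fD !add0r.
have : q (z + (s%:C * w) *: y) <= sup (range q).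
  by apply: sup_upper_bound => //; exists (z + (s%:C * w) *: y).
rewrite {1}/q snorm_sqrD_scale fD -[_ *: y]addr0 fl f0 addr0 => h.
have hw : complex.Re (Num.conj w * f y) - complex.Re (Num.conj w * b z y) = rnorm w ^+ 2.
  by rewrite -ReN -ReD -mulrBr mulrC mulcJ.
have hs : complex.Re (Num.conj (s%:C * w) * f y) = s * complex.Re (Num.conj w * f y).
  rewrite rmorphM /= -mulrA (_ : Num.conj s%:C = s%:C) ?conjcE ?conjc_real//.
  by rewrite ReM /= mul0r subr0.
move: h qz; rewrite /q ReD hs -hw; lra.
Qed.

End Semidot.

(** * Completion of a semi-inner product space, as its antidual *)

Section Antidual.
Variables (R : realType) (E : lmodType R[i]) (b : semidot E).

Definition antifunctional : {pred E -> R[i]} :=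
  [pred f | `[< antilinear f /\
    exists2 M : R, 0 <= M & forall x, rnorm (f x) <= M * snorm b x >]].

Record antidual := Antidual {
  antidual_fun :> E -> R[i]; _ : antidual_fun \in antifunctional }.

HB.instance Definition _ := [isSub of antidual for antidual_fun].
HB.instance Definition _ := [Choice of antidual by <:].

Lemma antifunctional_submod_closed : submod_closed antifunctional.
Proof.
split=> [|a f g].
  apply/asboolP; split; first by move=> c x y; rewrite /= mulr0 addr0.
  by exists 0 => // x; rewrite rnorm0 mul0r.
move=> /asboolP[fl [M M0 fM]] /asboolP[gl [N N0 gN]]; apply/asboolP; split.
  by move=> c x y; rewrite !fctE fl gl !mulrDr mulrCA /GRing.scale/=; ring.
exists (rnorm a * M + N); first by rewrite addr_ge0 ?mulr_ge0 ?rnorm_ge0.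
move=> x; rewrite !fctE (le_trans (rnormD _ _))// mulrDl lerD// rnormM -mulrA.
by rewrite ler_wpM2l ?rnorm_ge0.
Qed.

HB.instance Definition _ :=
  GRing.isSubmodClosed.Build R[i] (E -> R[i]) antifunctional
    antifunctional_submod_closed.
HB.instance Definition _ := [SubChoice_isSubLmodule of antidual by <:].

Implicit Types f g : antidual.

Lemma antidualP f : antilinear f.
Proof. by case: f => f /= /asboolP[]. Qed.

Lemma antidual_bounded f :
  exists2 M : R, 0 <= M & forall x, rnorm (f x) <= M * snorm b x.
Proof. by case: f => f /= /asboolP[]. Qed.

Lemma antidualB f x y : f (x - y) = f x - f y.
Proof. by rewrite addrC -scaleN1r antidualP rmorphN1 mulN1r addrC. Qed.

Definition dnorm f : R :=
  inf [set M : R | 0 <= M /\ forall x, rnorm (f x) <= M * snorm b x].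

Lemma dnorm_has_inf f :
  has_inf [set M : R | 0 <= M /\ forall x, rnorm (f x) <= M * snorm b x].
Proof.
have [M M0 fM] := antidual_bounded f.
by split; [exists M|exists 0 => ? []].
Qed.

Lemma dnorm_ge0 f : 0 <= dnorm f.
Proof. by apply: lb_le_inf => [|? []//]; have [] := dnorm_has_inf f. Qed.

Lemma dnorm_le f M : 0 <= M ->
  (forall x, rnorm (f x) <= M * snorm b x) -> dnorm f <= M.
Proof. by move=> M0 fM; apply: ge_inf => //; have [] := dnorm_has_inf f. Qed.

Lemma le_dnorm f x : rnorm (f x) <= dnorm f * snorm b x.
Proof.
have [M M0 fM] := antidual_bounded f.
have [x0|x0] := eqVneq (snorm b x) 0; first by have := fM x; rewrite x0 !mulr0.
have xp : 0 < snorm b x by rewrite lt_neqAle eq_sym x0 snorm_ge0.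
rewrite -ler_pdivrMr//; apply: lb_le_inf.
  by have [] := dnorm_has_inf f.
by move=> N [_ /(_ x)]; rewrite ler_pdivrMr.
Qed.

Lemma dnormD f g : dnorm (f + g) <= dnorm f + dnorm g.
Proof.
apply: dnorm_le => [|x]; first by rewrite addr_ge0 ?dnorm_ge0.
by rewrite (le_trans (rnormD _ _))// mulrDl lerD// le_dnorm.
Qed.

Lemma dnormZ (a : R[i]) f : dnorm (a *: f) = rnorm a * dnorm f.
Proof.
have le1 (c : R[i]) h : dnorm (c *: h) <= rnorm c * dnorm h.
  apply: dnorm_le => [|x]; first by rewrite mulr_ge0 ?rnorm_ge0 ?dnorm_ge0.
  by rewrite rnormM -mulrA ler_wpM2l ?rnorm_ge0// le_dnorm.
apply/eqP; rewrite eq_le le1/=; have [->|a0] := eqVneq a 0.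
  by rewrite rnorm0 mul0r dnorm_ge0.
have ap : 0 < rnorm a.
  rewrite lt_neqAle rnorm_ge0 andbT eq_sym.
  by apply: contra a0 => /eqP /rnorm0_eq0 ->.
rewrite mulrC -ler_pdivlMr//.
have := le1 a^-1 (a *: f); rewrite scalerA mulVf// scale1r => /le_trans; apply.
rewrite mulrC ler_wpM2l ?dnorm_ge0// -(ler_pM2r ap) mulVf ?gt_eqF//.
by rewrite -rnormM mulVf// rnorm1.
Qed.

Lemma dnorm0_eq0 f : dnorm f = 0 -> f = 0.
Proof.
move=> f0; apply: val_inj; apply/funext => x; apply: rnorm0_eq0.
by apply/eqP; rewrite eq_le rnorm_ge0 andbT (le_trans (le_dnorm f x))// f0 mul0r.
Qed.

Let dnormC_D f g : (dnorm (f + g))%:C <= (dnorm f)%:C + (dnorm g)%:C.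
Proof. by rewrite -rmorphD lecR dnormD. Qed.

Let dnormC_Z (a : R[i]) f : (dnorm (a *: f))%:C = `|a| * (dnorm f)%:C.
Proof. by rewrite dnormZ rnormE rmorphM. Qed.

Let dnormC0_eq0 f : (dnorm f)%:C = 0 -> f = 0.
Proof. by move=> [/dnorm0_eq0]. Qed.

HB.instance Definition _ := Lmodule_isNormed.Build R[i] antidual
  dnormC_D dnormC_Z dnormC0_eq0.

Lemma rnorm_dnorm f : rnorm f = dnorm f.
Proof. by []. Qed.

Lemma antidual_cauchy_cvg (F : set_system antidual) :
  ProperFilter F -> cauchy F -> cvg F.
Proof.
move=> FF Fc0; have Fc : forall e : R, 0 < e -> exists2 A, F A &
    forall f g, A f -> A g -> dnorm (f - g) <= e.
  move=> e e0; have e2 : 0 < (e / 2)%:C by rewrite ltcR divr_gt0.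
  have /cauchyP /(_ _ e2)[h Fh] := Fc0.
  exists (ball h (e / 2)%:C) => // f g; rewrite -!ball_normE /= => hf hg.
  rewrite (splitr e) -rnorm_dnorm (le_trans (rnorm_dist _ _ h))// lerD//.
    by rewrite rnorm_distC ltW// lt_rnorm_norm.
  by rewrite ltW// lt_rnorm_norm.
have fB f g x : f x - g x = (f - g) x by [].
have hl0 x : exists lx : R[i], forall e : R, 0 < e ->
    F [set f : antidual | rnorm (f x - lx) <= e].
  apply: cauchy_filter_cvg => e e0.
  have xp : 0 < snorm b x + 1 by rewrite ltr_wpDl ?snorm_ge0.
  have [A FA Ae] := Fc (e / (snorm b x + 1)) (divr_gt0 e0 xp).
  exists A => // f g Af Ag; rewrite fB (le_trans (le_dnorm _ _))//.
  rewrite (le_trans (ler_wpM2r (snorm_ge0 _ _) (Ae _ _ Af Ag)))//.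
  by rewrite -mulrA ger_pMr// mulrC ler_pdivrMr// mul1r lerDl.
have [l hl] := choice hl0.
have ul A e : F A -> 0 <= e -> (forall f g, A f -> A g -> dnorm (f - g) <= e) ->
    forall f x, A f -> rnorm (f x - l x) <= e * snorm b x.
  move=> FA e0 Ae f x Af; apply/ler_addgt0Pr => e' e'0.
  have [g [Ag gl]] := filter_ex (filterI FA (hl x e' e'0)).
  rewrite (le_trans (rnorm_dist _ _ (g x)))// lerD// fB.
  by rewrite (le_trans (le_dnorm _ _))// ler_wpM2r ?snorm_ge0// Ae.
have la : l \in antifunctional.
  apply/asboolP; split.
    move=> a x y; apply/eqP; rewrite -subr_eq0; apply/eqP.
    apply: (@rnorm_eps _ _ _ (1 + rnorm a + 1)) => e e0.
    have [f [[fx fy] fxy]] := filter_ex (filterI (filterI (hl x e e0) (hl y e e0))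
                                (hl (a *: x + y) e e0)).
    move: fx fy fxy => /= fx fy fxy.
    have -> : l (a *: x + y) - (Num.conj a * l x + l y) =
       - (f (a *: x + y) - l (a *: x + y)) + Num.conj a * (f x - l x) + (f y - l y).
      by rewrite antidualP; ring.
    rewrite (le_trans (rnormD _ _))// mulrDl lerD// ?mul1r//.
    rewrite (le_trans (rnormD _ _))// mulrDl mul1r rnormN lerD//.
    by rewrite rnormM rnorm_conj ler_wpM2l ?rnorm_ge0.
  have [A FA Ae] := Fc 1 ltr01; have [f Af] := filter_ex FA.
  exists (dnorm f + 1); first by rewrite addr_ge0 ?dnorm_ge0.
  move=> x; rewrite -[l x](subKr (f x)) (le_trans (rnormB _ _))// mulrDl lerD//.
    exact: le_dnorm.
  exact: ul FA _ Ae _ _ Af.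
apply/cvg_ex; exists (Antidual la); apply/cvgrPdist_le => e e0.
have eR : e = (complex.Re e)%:C by apply/ge0_ReC/ltW.
have e'0 : 0 < complex.Re e by rewrite -ltcR -eR.
have [A FA Ae] := Fc _ e'0; apply: (filterS _ FA) => f Af.
rewrite distrC eR -le_rnorm_norm rnorm_dnorm; apply: dnorm_le (ltW e'0) _ => x.
exact: ul FA (ltW e'0) Ae _ _ Af.
Qed.

HB.instance Definition _ := Uniform_isComplete.Build antidual antidual_cauchy_cvg.

Lemma inj_subproof (x : E) : b x \in antifunctional.
Proof.
apply/asboolP; split; first exact: antilinear_sdot.
by exists (snorm b x) => [|y]; [exact: snorm_ge0|exact: sdot_CauchySchwarz].
Qed.

Definition adinj (x : E) : antidual := Antidual (inj_subproof x).

Lemma adinj_linear : linear adinj.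
Proof. by move=> a x y; apply: val_inj; apply/funext => z; rewrite /= sdotP. Qed.

HB.instance Definition _ :=
  GRing.isLinear.Build R[i] E antidual *:%R adinj adinj_linear.

Lemma dnorm_adinj x : dnorm (adinj x) = snorm b x.
Proof.
apply/eqP; rewrite eq_le; apply/andP; split.
  by apply: dnorm_le => [|y]; [exact: snorm_ge0|exact: sdot_CauchySchwarz].
by apply: (@snorm_le_dual _ _ b) => [|y]; [exact: dnorm_ge0|exact: (le_dnorm (adinj x))].
Qed.

Lemma adinj_dense f e : 0 < e -> exists x, dnorm (f - adinj x) <= e.
Proof.
move=> e0; have [z zf] := antilinear_approx (antidualP f) (le_dnorm f) e0.
by exists z; apply: dnorm_le (ltW e0) _ => y; exact: zf.
Qed.

(* [<f, g>] is the limit of [f z] as [adinj z] tends to [g]. *)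
Let addot_ex f g : exists w : R[i], forall z,
  rnorm (f z - w) <= dnorm f * dnorm (g - adinj z).
Proof.
have e0 n : 0 < n.+1%:R^-1 :> R by rewrite invr_gt0.
have [z zg] := choice (fun n => adinj_dense g (e0 n)).
have fz y t : rnorm (f y - f t) <= dnorm f * dnorm (adinj y - adinj t).
  by rewrite -antidualB (le_trans (le_dnorm _ _))// -linearB dnorm_adinj.
have dist h k l : dnorm (h - k) <= dnorm (h - l) + dnorm (l - k).
  by rewrite -!rnorm_dnorm rnorm_dist.
have distC h k : dnorm (h - k) = dnorm (k - h).
  by rewrite -[LHS]rnorm_dnorm rnorm_distC.
have r0 (eps : R) : 0 < eps ->
    exists N, forall n, (N <= n)%N -> dnorm f * n.+1%:R^-1 <= eps.
  exact: invn_small (dnorm_ge0 f).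
have [|w hw] := cauchy_seq_cvg r0 (h := f \o z).
  move=> m n /=; rewrite (le_trans (fz _ _))// -mulrDr ler_wpM2l ?dnorm_ge0//.
  by rewrite (le_trans (dist _ _ g))// lerD// distC.
exists w => y; apply/ler_addgt0Pr => e ep.
have [N /(_ N (leqnn _)) Ne] := r0 _ (divr_gt0 ep (ltr0Sn _ 1)).
rewrite (le_trans (rnorm_dist _ _ (f (z N))))//.
rewrite (le_trans (lerD (fz _ _) (hw N)))//.
have := dist (adinj y) (adinj (z N)) g; rewrite (distC _ g) => h.
have h1 := ler_wpM2l (dnorm_ge0 f) h; have h2 := ler_wpM2l (dnorm_ge0 f) (zg N).
apply: le_trans (lerD h1 (lexx _)) _; rewrite mulrDr.
by rewrite -addrA lerD2l (splitr e) lerD// (le_trans h2).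
Qed.

Definition addot f g : R[i] := sval (cid (addot_ex f g)).

Lemma addot_approx f g z : rnorm (f z - addot f g) <= dnorm f * dnorm (g - adinj z).
Proof. by rewrite /addot; case: cid. Qed.

Lemma addot_inj f z : addot f (adinj z) = f z.
Proof.
apply/eqP; rewrite eq_sym -subr_eq0; apply/eqP.
apply: (@rnorm_eps _ _ _ 0) => e e0; rewrite mul0r.
rewrite (le_trans (addot_approx f (adinj z) z))// subrr.
by rewrite -[dnorm 0]rnorm_dnorm rnorm0 mulr0.
Qed.

Lemma addotPl a f g h : addot (a *: f + g) h = a * addot f h + addot g h.
Proof.
apply/eqP; rewrite -subr_eq0; apply/eqP.
apply: (@rnorm_eps _ _ _ (dnorm (a *: f + g) + (rnorm a * dnorm f + dnorm g))).
move=> e e0; have [z hz] := adinj_dense h e0.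
have le (k : antidual) : rnorm (k z - addot k h) <= dnorm k * e.
  by rewrite (le_trans (addot_approx _ _ z))// ler_wpM2l ?dnorm_ge0.
have -> : addot (a *: f + g) h - (a * addot f h + addot g h) =
    - (a * f z + g z - addot (a *: f + g) h) + (a * (f z - addot f h)
       + (g z - addot g h)).
  by ring.
rewrite (le_trans (rnormD _ _))// mulrDl lerD//.
  by rewrite rnormN; exact: (le (a *: f + g)).
rewrite (le_trans (rnormD _ _))// mulrDl lerD//.
by rewrite rnormM -mulrA ler_wpM2l ?rnorm_ge0.
Qed.

Lemma addotC f g : addot f g = Num.conj (addot g f).
Proof.
apply/eqP; rewrite -subr_eq0; apply/eqP.
apply: (@rnorm_eps _ _ _ (dnorm f + dnorm g + (dnorm g + 1 + (dnorm f + 1)))) => e e0.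
pose e' := Num.min e 1.
have e'0 : 0 < e' by rewrite /e' lt_min e0 ltr01.
have e'1 : e' <= 1 by rewrite /e' ge_min lexx orbT.
have e'e : e' <= e by rewrite /e' ge_min lexx.
have [x fx] := adinj_dense f e'0; have [z gz] := adinj_dense g e'0.
have le1 : rnorm (f z - addot f g) <= dnorm f * e'.
  by rewrite (le_trans (addot_approx _ _ z))// ler_wpM2l ?dnorm_ge0.
have le2 : rnorm (g x - addot g f) <= dnorm g * e'.
  by rewrite (le_trans (addot_approx _ _ x))// ler_wpM2l ?dnorm_ge0.
have zb : snorm b z <= dnorm g + 1.
  rewrite -dnorm_adinj -(subKr g (adinj z)) -rnorm_dnorm (le_trans (rnormB _ _))// lerD//.
  exact: le_trans gz e'1.
have xb : snorm b x <= dnorm f + 1.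
  rewrite -dnorm_adinj -(subKr f (adinj x)) -rnorm_dnorm (le_trans (rnormB _ _))// lerD//.
  exact: le_trans fx e'1.
have le3 : rnorm (f z - b x z) <= e' * (dnorm g + 1).
  apply: le_trans (le_dnorm (f - adinj x) z) _.
  by rewrite ler_pM ?dnorm_ge0 ?snorm_ge0.
have le4 : rnorm (g x - b z x) <= e' * (dnorm f + 1).
  apply: le_trans (le_dnorm (g - adinj z) x) _.
  by rewrite ler_pM ?dnorm_ge0 ?snorm_ge0.
have -> : addot f g - Num.conj (addot g f) = - (f z - addot f g) + (f z - b x z)
   + (Num.conj (g x - addot g f) - Num.conj (g x - b z x)).
  by rewrite !rmorphB /= -(sdotC b z x); ring.
have C0 : 0 <= dnorm f + dnorm g + (dnorm g + 1 + (dnorm f + 1)).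
  by rewrite !addr_ge0 ?dnorm_ge0.
apply: le_trans (ler_wpM2l C0 e'e).
have -> : (dnorm f + dnorm g + (dnorm g + 1 + (dnorm f + 1))) * e' =
    dnorm f * e' + e' * (dnorm g + 1) + (dnorm g * e' + e' * (dnorm f + 1)) by ring.
rewrite (le_trans (rnormD _ _))// lerD//.
  by rewrite (le_trans (rnormD _ _))// rnormN lerD.
by rewrite (le_trans (rnormB _ _))// !rnorm_conj lerD.
Qed.

Lemma addotxx f : addot f f = (dnorm f ^+ 2)%:C.
Proof.
apply/eqP; rewrite -subr_eq0; apply/eqP.
apply: (@rnorm_eps _ _ _ (dnorm f + (dnorm f + 1) + (dnorm f + 1 + dnorm f))) => e e0.
pose e' := Num.min e 1.
have e'0 : 0 < e' by rewrite /e' lt_min e0 ltr01.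
have e'1 : e' <= 1 by rewrite /e' ge_min lexx orbT.
have e'e : e' <= e by rewrite /e' ge_min lexx.
have [x fx] := adinj_dense f e'0.
have le2 : rnorm (f x - addot f f) <= dnorm f * e'.
  by rewrite (le_trans (addot_approx _ _ x))// ler_wpM2l ?dnorm_ge0.
have xb : snorm b x <= dnorm f + 1.
  rewrite -dnorm_adinj -(subKr f (adinj x)) -rnorm_dnorm (le_trans (rnormB _ _))// lerD//.
  exact: le_trans fx e'1.
have le3 : rnorm (f x - b x x) <= e' * (dnorm f + 1).
  apply: le_trans (le_dnorm (f - adinj x) x) _.
  by rewrite ler_pM ?dnorm_ge0 ?snorm_ge0.
have dx : `|snorm b x - dnorm f| <= e'.
  rewrite -dnorm_adinj (le_trans _ fx)// -!rnorm_dnorm ler_norml; apply/andP; split.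
    by rewrite lerNl opprB lerBlDr -{1}(subrK (adinj x) f) rnormD.
  by rewrite lerBlDr rnorm_distC -{1}(subrK f (adinj x)) rnormD.
have le4 : rnorm (b x x - (dnorm f ^+ 2)%:C) <= e' * (dnorm f + 1 + dnorm f).
  rewrite sdotxx -rmorphB /= rnormC subr_sqr normrM ler_pM//.
  by rewrite ger0_norm ?addr_ge0 ?snorm_ge0 ?dnorm_ge0// lerD2r.
have -> : addot f f - (dnorm f ^+ 2)%:C = - (f x - addot f f) + (f x - b x x)
   + (b x x - (dnorm f ^+ 2)%:C) by ring.
have C0 : 0 <= dnorm f + (dnorm f + 1) + (dnorm f + 1 + dnorm f).
  by rewrite !addr_ge0 ?dnorm_ge0.
apply: le_trans (ler_wpM2l C0 e'e).
have -> : (dnorm f + (dnorm f + 1) + (dnorm f + 1 + dnorm f)) * e' =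
    dnorm f * e' + e' * (dnorm f + 1) + e' * (dnorm f + 1 + dnorm f) by ring.
rewrite (le_trans (rnormD _ _))// lerD//.
by rewrite (le_trans (rnormD _ _))// rnormN lerD.
Qed.

Let addot_bilinear : bilinear_for (GRing.Scale.Law.clone _ _ ( *%R ) _)
  (GRing.Scale.Law.clone _ _ (Num.conj \; *%R) _ : R[i] -> R[i] -> R[i]) addot.
Proof.
split=> [h a f g|h a f g]; first exact: addotPl.
by rewrite addotC addotPl rmorphD rmorphM /= -!(addotC h).
Qed.

HB.instance Definition _ := bilinear_isBilinear.Build R[i] antidual antidual R[i]
  _ _ addot addot_bilinear.

Let addot_herm f g : addot f g = (-1) ^+ false * Num.conj (addot g f).
Proof. by rewrite mul1r -addotC. Qed.

HB.instance Definition _ := isHermitianSesquilinear.Build R[i] antidual false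
  Num.conj addot addot_herm.

Let addot_gt0 f : f != 0 -> 0 < addot f f.
Proof.
move=> f0; rewrite addotxx ltcR exprn_gt0// lt_neqAle dnorm_ge0 andbT eq_sym.
by apply: contra f0 => /eqP/dnorm0_eq0 ->.
Qed.

HB.instance Definition _ := isDotProduct.Build R[i] antidual addot addot_gt0.

Let addot_norm f : addot f f = `|f| ^+ 2.
Proof. by rewrite rnormE addotxx rmorphXn. Qed.

Definition antidual_hilbert : hilbertType R :=
  @HilbertType R antidual (addot : {dot antidual for Num.conj}) addot_norm.

End Antidual.

(** * Operators on Hilbert spaces *)

Section Hilbert.
Variables (R : realType) (H : hilbertType R).

Let hdot_sdotP a (x y z : H) : hdot H (a *: x + y) z = a * hdot H x z + hdot H y z.
Proof. by rewrite linearPl. Qed.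

Let hdot_sdotC (x y : H) : hdot H y x = Num.conj (hdot H x y).
Proof. by rewrite (@hermitian_subproof _ _ _ _ (hdot H)) mul1r. Qed.

Let hdot_sdotxx_ge0 (x : H) : 0 <= hdot H x x.
Proof. by rewrite hdot_norm exprn_ge0. Qed.

Definition hsd : semidot H := Semidot hdot_sdotP hdot_sdotC hdot_sdotxx_ge0.

Lemma hsdE (x y : H) : hdot H x y = hsd x y.
Proof. by []. Qed.

Lemma snorm_hsd (x : H) : snorm hsd x = rnorm x.
Proof.
apply/eqP; rewrite -(@eqrXn2 _ 2)// ?snorm_ge0 ?rnorm_ge0//; apply/eqP.
by apply: complexI; rewrite -sdotxx -hsdE hdot_norm rnormE rmorphXn.
Qed.

Lemma hdot_CauchySchwarz (x y : H) : rnorm (hdot H x y) <= rnorm x * rnorm y.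
Proof. by rewrite -(snorm_hsd x) -(snorm_hsd y); exact: sdot_CauchySchwarz hsd x y. Qed.

Lemma hdotxx (x : H) : hdot H x x = (rnorm x ^+ 2)%:C.
Proof. by rewrite -snorm_hsd -sdotxx. Qed.

Lemma hdot_inj (x x' : H) : (forall y, hdot H x y = hdot H x' y) -> x = x'.
Proof.
move=> xx'; apply/eqP; rewrite -subr_eq0; apply/eqP/rnorm0_eq0/eqP.
rewrite -sqrf_eq0; apply/eqP/complexI.
by rewrite -hdotxx hsdE sdotBl -!hsdE xx' subrr.
Qed.

Lemma hdot_injr (x x' : H) : (forall y, hdot H y x = hdot H y x') -> x = x'.
Proof.
by move=> xx'; apply: hdot_inj => y; rewrite !hsdE !(sdotC hsd y) -!hsdE xx'.
Qed.

Lemma hilbert_cauchy_seq_cvg (h : nat -> H) (r : nat -> R) :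
  (forall e, 0 < e -> exists N, forall n, (N <= n)%N -> r n <= e) ->
  (forall m n, rnorm (h m - h n) <= r m + r n) ->
  exists l, forall n, rnorm (h n - l) <= r n.
Proof.
move=> r0 hr.
have /cvg_ex[l hl] : cvg (h @ \oo).
  apply: cauchy_cvg; apply/cauchyP => e e0.
  have eR : e = (complex.Re e)%:C by apply/ge0_ReC/ltW.
  have e'0 : 0 < complex.Re e by rewrite -ltcR -eR.
  have [N Ne] := r0 (complex.Re e / 3) (divr_gt0 e'0 (ltr0Sn _ 2)).
  exists (h N); exists N => // n /= Nn; rewrite -ball_normE /=.
  rewrite eR -lt_rnorm_norm (le_lt_trans (hr _ _))//.
  have := Ne N (leqnn N); have := Ne n Nn; lra.
exists l => n; apply/ler_addgt0Pr => e e0.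
have e2 : 0 < e / 2 by rewrite divr_gt0.
have e2C : 0 < (e / 2)%:C by rewrite ltcR.
have [N Ne] := r0 _ e2.
move/cvgrPdist_le : hl => /(_ _ e2C) hl.
have [m [/= ml Nm]] := filter_ex (filterI hl (nbhs_infty_ge N)).
move: ml; rewrite distrC -le_rnorm_norm => ml.
rewrite (le_trans (rnorm_dist _ _ (h m)))//.
rewrite (le_trans (lerD (hr _ _) ml))// -addrA lerD2l.
by rewrite [leRHS](splitr e) lerD2r Ne.
Qed.

Lemma riesz (f : H -> R[i]) (M : R) : antilinear f ->
  (forall x, rnorm (f x) <= M * rnorm x) -> exists z, forall x, f x = hdot H z x.
Proof.
move=> fl fM.
have fM' x : rnorm (f x) <= M * snorm hsd x by rewrite snorm_hsd.
have e0 n : 0 < n.+1%:R^-1 :> R by rewrite invr_gt0.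
have [z zf] := choice (fun n => antilinear_approx fl fM' (e0 n)).
have r0 (e : R) : 0 < e -> exists N, forall n, (N <= n)%N -> n.+1%:R^-1 <= e.
  by move=> ep; have [N Ne] := invn_small ler01 ep; exists N => n /Ne; rewrite mul1r.
have [|l zl] := hilbert_cauchy_seq_cvg r0 (h := z).
  move=> m n; rewrite -snorm_hsd; apply: (@snorm_le_dual _ _ hsd).
    by rewrite addr_ge0 ?ltW.
  move=> y; rewrite sdotBl mulrDl.
  rewrite (le_trans (rnorm_dist _ _ (f y)))// lerD ?zf//.
  by rewrite rnorm_distC zf.
exists l => y; apply/eqP; rewrite -subr_eq0; apply/eqP.
apply: (@rnorm_eps _ _ _ (rnorm y + rnorm y)) => e ep.
have [N /(_ N (leqnn _)) Ne] := r0 e ep.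
rewrite (le_trans (rnorm_dist _ _ (hsd (z N) y)))// mulrDl lerD//.
  by rewrite (le_trans (zf _ _))// snorm_hsd mulrC ler_wpM2l ?rnorm_ge0.
rewrite hsdE -sdotBl (le_trans (hdot_CauchySchwarz _ _))// mulrC.
by rewrite ler_wpM2l ?rnorm_ge0// (le_trans (zl N)).
Qed.

End Hilbert.

Section Bop.
Variable R : realType.
Implicit Types H K L : hilbertType R.

Lemma mkbop_subproof H K (f : H -> K) (fl : linear f)
  (fM : exists M : R, forall x, rnorm (f x) <= M * rnorm x) :
  f \in bounded_linear H K.
Proof.
apply/asboolP; split=> //; have [M Mf] := fM.
by exists M%:C => x; rewrite !rnormE -rmorphM lecR.
Qed.

Definition mkbop H K f fl fM : bop H K := Bop (@mkbop_subproof H K f fl fM).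

Lemma bop_rbounded H K (T : bop H K) :
  exists2 M : R, 0 <= M & forall x, rnorm (T x) <= M * rnorm x.
Proof.
have [M M0 TM] := bop_bounded T; exists (complex.Re M); first exact: ge0_Re.
by move=> x; rewrite -lecR rmorphM /= -!rnormE -ge0_ReC.
Qed.

Lemma bop_eq H K (S T : bop H K) : (forall x, S x = T x) -> S = T.
Proof. by move=> ST; apply: val_inj; apply/funext. Qed.

Lemma bopD H K (S T : bop H K) x : (S + T) x = S x + T x.
Proof. by []. Qed.

Lemma bopB H K (S T : bop H K) x : (S - T) x = S x - T x.
Proof. by []. Qed.

Lemma bopZ H K (a : R[i]) (T : bop H K) x : (a *: T) x = a *: T x.
Proof. by []. Qed.

Lemma adj_ex H K (T : bop H K) : exists S : bop K H, is_adjoint T S.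
Proof.
have [M M0 TM] := bop_rbounded T.
have h y : exists z, forall x, hdot K y (T x) = hdot H z x.
  apply: (@riesz _ H _ (rnorm y * M)) => [a x x'|x].
    by rewrite linearP hsdE sdotDr sdotZr.
  rewrite (le_trans (hdot_CauchySchwarz _ _))// -mulrA.
  by rewrite ler_wpM2l ?rnorm_ge0.
have [S ST] := choice h.
have Sl : linear S.
  move=> a y y'; apply: hdot_inj => x.
  by rewrite -ST [RHS]hsdE !(sdotP (hsd _)) -!hsdE -!ST hsdE sdotP.
have SM : exists M : R, forall x, rnorm (S x) <= M * rnorm x.
  exists M => y; rewrite -snorm_hsd; apply: (@snorm_le_dual _ _ (hsd H)).
    by rewrite mulr_ge0 ?rnorm_ge0.
  move=> x; rewrite snorm_hsd -hsdE -ST (le_trans (hdot_CauchySchwarz _ _))//.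
  by rewrite mulrC mulrAC ler_wpM2r ?rnorm_ge0.
exists (mkbop Sl SM) => x y /=.
by rewrite !hsdE (sdotC _ y) (sdotC _ (S y)) -!hsdE ST.
Qed.

Definition adj H K (T : bop H K) : bop K H := sval (cid (adj_ex T)).

Lemma adjP H K (T : bop H K) : is_adjoint T (adj T).
Proof. by rewrite /adj; case: cid. Qed.

Lemma hdot_adjr H K (T : bop H K) x y : hdot H x (adj T y) = hdot K (T x) y.
Proof. by rewrite adjP. Qed.

Lemma hdot_adjl H K (T : bop H K) x y : hdot H (adj T y) x = hdot K y (T x).
Proof. by rewrite !hsdE (sdotC _ x) (sdotC _ (T x)) -!hsdE adjP. Qed.

Lemma is_adjointE H K (T : bop H K) (S : bop K H) : is_adjoint T S -> S = adj T.
Proof.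
by move=> TS; apply: bop_eq => y; apply: hdot_injr => x; rewrite hdot_adjr TS.
Qed.

Lemma adjK H K (T : bop H K) : adj (adj T) = T.
Proof. by apply/esym/is_adjointE => y x; rewrite hdot_adjl. Qed.

Lemma adjPl H K (a : R[i]) (S T : bop H K) :
  adj (a *: S + T) = Num.conj a *: adj S + adj T.
Proof.
apply/esym/is_adjointE => x y.
rewrite bopD bopZ (bopD _ _ y) bopZ !hsdE sdotP sdotDr sdotZr -!hsdE.
by rewrite !hdot_adjr conjCK.
Qed.

Lemma adj0 H K : adj (0 : bop H K) = 0.
Proof. by apply/esym/is_adjointE => x y; rewrite !hsdE sdot0l sdot0r. Qed.

Lemma adjD H K (S T : bop H K) : adj (S + T) = adj S + adj T.
Proof. by rewrite -{1}[S]scale1r adjPl rmorph1 scale1r. Qed.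

Lemma adjZ H K (a : R[i]) (T : bop H K) : adj (a *: T) = Num.conj a *: adj T.
Proof. by rewrite -[a *: T]addr0 adjPl adj0 addr0. Qed.

Lemma adjB H K (S T : bop H K) : adj (S - T) = adj S - adj T.
Proof. by rewrite adjD -scaleN1r adjZ rmorphN1 scaleN1r. Qed.

Lemma adj_comp H K L (S : bop K L) (T : bop H K) :
  adj (bcomp S T) = bcomp (adj T) (adj S).
Proof. by apply/esym/is_adjointE => x y /=; rewrite !hdot_adjr. Qed.

Lemma adj_bid H : adj (bid H) = bid H.
Proof. by apply/esym/is_adjointE. Qed.

Lemma bcompA H1 H2 H3 H4 (S : bop H3 H4) (T : bop H2 H3) (U : bop H1 H2) :
  bcomp S (bcomp T U) = bcomp (bcomp S T) U.
Proof. exact: bop_eq. Qed.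

Lemma bcomp1l H K (T : bop H K) : bcomp (bid K) T = T.
Proof. exact: bop_eq. Qed.

Lemma bcomp1r H K (T : bop H K) : bcomp T (bid H) = T.
Proof. exact: bop_eq. Qed.

Lemma bcompPl H K L (a : R[i]) (S S' : bop K L) (T : bop H K) :
  bcomp (a *: S + S') T = a *: bcomp S T + bcomp S' T.
Proof. exact: bop_eq. Qed.

Lemma bcompPr H K L (a : R[i]) (S : bop K L) (T T' : bop H K) :
  bcomp S (a *: T + T') = a *: bcomp S T + bcomp S T'.
Proof. by apply: bop_eq => x; rewrite /= linearP. Qed.

Lemma bcompZl H K L (a : R[i]) (S : bop K L) (T : bop H K) :
  bcomp (a *: S) T = a *: bcomp S T.
Proof. exact: bop_eq. Qed.

Lemma bcompZr H K L (a : R[i]) (S : bop K L) (T : bop H K) :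
  bcomp S (a *: T) = a *: bcomp S T.
Proof. by apply: bop_eq => x; rewrite /= linearZ. Qed.

Lemma unitary_adj H (T : bop H H) : unitary_op T ->
  bcomp (adj T) T = bid H /\ bcomp T (adj T) = bid H.
Proof. by move=> [S [/is_adjointE <-]]. Qed.

Lemma adj_bounded H K (T : bop H K) (M : R) :
  (forall x, rnorm (T x) <= M * rnorm x) ->
  0 <= M -> forall y, rnorm (adj T y) <= M * rnorm y.
Proof.
move=> TM M0 y; rewrite -snorm_hsd; apply: (@snorm_le_dual _ _ (hsd H)).
  by rewrite mulr_ge0 ?rnorm_ge0.
move=> x; rewrite snorm_hsd -hsdE hdot_adjl (le_trans (hdot_CauchySchwarz _ _))//.
by rewrite mulrC mulrAC ler_wpM2r ?rnorm_ge0.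
Qed.

Lemma isometry_adj H K (J : bop H K) :
  (forall x y, hdot K (J x) (J y) = hdot H x y) -> bcomp (adj J) J = bid H.
Proof. by move=> Jiso; apply: bop_eq => x; apply: hdot_inj => y; rewrite hdot_adjl. Qed.

Lemma isometry_projection H K (J : bop H K) :
  (forall x y, hdot K (J x) (J y) = hdot H x y) ->
  orthogonal_projection (range J) (bcomp J (adj J)).
Proof.
move=> Jiso k; split; first by exists (adj J k).
move=> _ [x _ <-]; rewrite hsdE sdotBl -!hsdE Jiso.
by rewrite hdot_adjl subrr.
Qed.

Lemma opnorm_le H K (T : bop H K) (M : R) : 0 <= M ->
  (forall x, rnorm (T x) <= M * rnorm x) -> (opnorm T <= M%:E)%E.
Proof.
move=> M0 TM; apply: ge_ereal_sup => _ [x /= x1 <-].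
rewrite lee_fin (le_trans (TM x))// -[leRHS]mulr1 ler_wpM2l//.
by rewrite le_rnorm_norm.
Qed.

Lemma opnorm_lt H K (T : bop H K) (e : R) :
  (opnorm T < e%:E)%E -> forall x, rnorm (T x) <= e * rnorm x.
Proof.
move=> Te x.
have h y : rnorm y <= 1 -> rnorm (T y) <= e.
  rewrite le_rnorm_norm => y1; rewrite -lee_fin ltW//.
  by apply: le_lt_trans Te; apply: ereal_sup_ubound; exists y.
have [->|x0] := eqVneq x 0; first by rewrite linear0 !rnorm0 mulr0.
have xp : 0 < rnorm x by rewrite -ltcR -rnormE normr_gt0.
have := h ((rnorm x)^-1%:C *: x); rewrite linearZ /= !rnormZ rnormC.
rewrite ger0_norm ?invr_ge0 ?rnorm_ge0// mulVf ?gt_eqF// => /(_ (lexx _)).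
by rewrite mulrC ler_pdivrMr.
Qed.

End Bop.

(** * Contractive matrices *)

Section ContractiveMatrices.
Variable R : realType.
Local Notation C := R[i].
Local Open Scope sesquilinear_scope.

Section Form.
Variable n : nat.

Let cdot (x y : 'cV[C]_n) := \sum_i x i 0 * Num.conj (y i 0).

Let cdotP a x y z : cdot (a *: x + y) z = a * cdot x z + cdot y z.
Proof.
rewrite /cdot mulr_sumr -big_split /=; apply: eq_bigr => i _.
by rewrite !mxE mulrDl mulrA.
Qed.

Let cdotC x y : cdot y x = Num.conj (cdot x y).
Proof.
rewrite /cdot rmorph_sum /=; apply: eq_bigr => i _.
by rewrite rmorphM /= conjCK mulrC.
Qed.

Let cdotxx_ge0 x : 0 <= cdot x x.
Proof. by rewrite sumr_ge0// => i _; rewrite mul_conjC_ge0. Qed.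

Definition csd : semidot 'cV[C]_n := Semidot cdotP cdotC cdotxx_ge0.

Lemma csdE x y : csd x y = (y^t* *m x) 0 0.
Proof.
by rewrite mxE; apply: eq_bigr => i _; rewrite !mxE mulrC.
Qed.

Lemma l2normE x : l2norm x = snorm csd x.
Proof.
rewrite /l2norm /snorm Re_sum; congr Num.sqrt; apply: eq_bigr => i _.
by rewrite mulcJ.
Qed.

End Form.

Lemma csd_eq0 n (z : 'cV[C]_n) : snorm (csd n) z = 0 -> z = 0.
Proof.
rewrite -l2normE /l2norm => /eqP; rewrite sqrtr_eq0 => z0.
apply/colP => i; rewrite mxE; apply/rnorm0_eq0/eqP; rewrite -sqrf_eq0.
have : \sum_i rnorm (z i 0) ^+ 2 == 0.
  by rewrite eq_le z0 sumr_ge0// => j _; rewrite sqr_ge0.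
rewrite psumr_eq0 => [/allP/(_ i)|j _]; last by rewrite sqr_ge0.
by rewrite mem_index_enum => /(_ isT).
Qed.

Lemma mxopnorm_lt n (X : 'M[C]_n) (e : R) : (mxopnorm X < e%:E)%E ->
  forall z, snorm (csd n) (X *m z) <= e * snorm (csd n) z.
Proof.
move=> Xe z; have h y : snorm (csd n) y <= 1 -> snorm (csd n) (X *m y) <= e.
  rewrite -!l2normE => y1; rewrite -lee_fin ltW//.
  by apply: le_lt_trans Xe; apply: ereal_sup_ubound; exists y.
have [z0|z0] := eqVneq (snorm (csd n) z) 0; last first.
  have zp : 0 < snorm (csd n) z by rewrite lt_neqAle eq_sym z0 snorm_ge0.
  have := h ((snorm (csd n) z)^-1%:C *: z); rewrite -scalemxAr !snormZ rnormC.
  rewrite ger0_norm ?invr_ge0 ?snorm_ge0// mulVf// => /(_ (lexx _)).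
  by rewrite mulrC ler_pdivrMr.
by rewrite (csd_eq0 z0) mulmx0 snorm0 mulr0.
Qed.

(* [Z] is a combination [sum_k lam_k q_k q_k^*] with [|lam_k| <= 1] and
   [sum_k q_k q_k^* = 1]. *)
Definition disk_decomposable n (Z : 'M[C]_n) := exists s : seq (C * 'cV[C]_n),
  [/\ forall p, p \in s -> rnorm p.1 <= 1,
      \sum_(p <- s) p.2 *m p.2^t* = 1%:M &
      Z = \sum_(p <- s) p.1 *: (p.2 *m p.2^t*)].

Lemma disk_decomposable_convex n (t : R) (Y Z : 'M[C]_n) : 0 <= t <= 1 ->
  disk_decomposable Y -> disk_decomposable Z ->
  disk_decomposable (t%:C *: Y + (1 - t)%:C *: Z).
Proof.
move=> /andP[t0 t1] [s1 [l1 o1 ->]] [s2 [l2 o2 ->]].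
pose sc (c : R) (p : C * 'cV[C]_n) := (p.1, (Num.sqrt c)%:C *: p.2).
have scE c (p : C * 'cV[C]_n) : 0 <= c ->
    (sc c p).2 *m ((sc c p).2)^t* = c%:C *: (p.2 *m p.2^t*).
  move=> c0 /=; rewrite linearZ /= map_mxZ -scalemxAl -scalemxAr scalerA.
  by rewrite mulcJ rnormC real_normK ?num_real// sqr_sqrtr.
exists (map (sc t) s1 ++ map (sc (1 - t)) s2); split.
- move=> p; rewrite mem_cat => /orP[/mapP[q qs ->]|/mapP[q qs ->]] /=.
    exact: (l1 q).
  exact: (l2 q).
- rewrite big_cat !big_map /=.
  under eq_bigr do rewrite (scE t)//; rewrite -scaler_sumr o1.
  under eq_bigr do rewrite (scE (1 - t)) ?subr_ge0//; rewrite -scaler_sumr o2.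
  by rewrite -scalerDl -rmorphD /= addrC subrK scale1r.
- rewrite big_cat !big_map /= !scaler_sumr; congr (_ + _); apply: eq_bigr => p _.
    by rewrite (scE t)// !scalerA mulrC.
  by rewrite (scE (1 - t)) ?subr_ge0// !scalerA mulrC.
Qed.

Lemma unitarymx_tr n (M : 'M[C]_n) : M \is unitarymx -> M^t* *m M = 1%:M.
Proof. by move=> /unitarymxP /mulmx1C. Qed.

Lemma unitarymx_disk_decomposable n (Y : 'M[C]_n) :
  Y \is unitarymx -> disk_decomposable Y.
Proof.
move=> Yu; have YY := unitarymxP Yu; have YY' := unitarymx_tr Yu.
have /orthomx_spectralP : Y \is normalmx by apply/normalmxP; rewrite YY.
have Pu := spectral_unitarymx Y; rewrite (invmx_unitary Pu).
move: (spectralmx Y) (spectral_diag Y) Pu => P D Pu YE.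
have PP := unitarymxP Pu; have PP' := unitarymx_tr Pu.
have DE : diag_mx D = P *m Y *m P^t*.
  by rewrite YE !mulmxA PP mul1mx -mulmxA PP mulmx1.
have Du : diag_mx D *m (diag_mx D)^t* = 1%:M.
  apply/unitarymxP; rewrite DE; apply: mul_unitarymx; last by rewrite trmxC_unitary.
  exact: mul_unitarymx.
have D1 j : rnorm (D 0 j) = 1.
  have := congr1 (fun M : 'M[C]_n => M j j) Du; rewrite !mxE (bigD1 j)//= big1 ?addr0.
    rewrite !mxE eqxx mulr1n mulcJ => /complexI /eqP.
    by rewrite sqrp_eq1 ?rnorm_ge0// => /eqP.
  by move=> k kj; rewrite !mxE eq_sym (negbTE kj) mulr0n mul0r.
exists [seq (D 0 j, (row j P)^t*) | j <- enum 'I_n]; split.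
- by move=> p /mapP[j _ ->] /=; rewrite D1.
- rewrite big_map big_enum /= -PP'; apply/matrixP => a b; rewrite summxE mxE.
  by apply: eq_bigr => k _; rewrite !mxE big_ord1 !mxE conjCK.
- rewrite big_map big_enum /= {1}YE; apply/matrixP => a b; rewrite summxE mxE.
  apply: eq_bigr => k _; rewrite !mxE big_ord1 !mxE conjCK mulrA.
  congr (_ * _); rewrite (bigD1 k)//= big1 ?addr0.
    by rewrite !mxE eqxx mulr1n mulrC.
  by move=> j jk; rewrite !mxE (negbTE jk) mulr0n mulr0.
Qed.

(* In the polar decomposition, a singular value [s] is the mean of the unimodular
   numbers [s +- i sqrt (1 - s^2)]. *)
Lemma unit_contraction_disk_decomposable n (Z : 'M[C]_n) : Z \in unitmx ->
  (forall z, snorm (csd n) (Z *m z) <= snorm (csd n) z) -> disk_decomposable Z.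
Proof.
move=> Zu Zc; pose A := Z^t* *m Z.
have trC m p (M : 'M[C]_(m, p)) : (M^t*)^t* = M.
  by apply/matrixP => i j; rewrite !mxE conjCK.
have trM m p q (M : 'M[C]_(m, p)) (N : 'M[C]_(p, q)) :
    (M *m N)^t* = N^t* *m M^t* by rewrite trmx_mul map_mxM.
have /orthomx_spectralP : A \is normalmx by apply/normalmxP; rewrite /A trM trC.
have Pu := spectral_unitarymx A; rewrite (invmx_unitary Pu).
move: (spectralmx A) (spectral_diag A) Pu => P D Pu AE.
have PP := unitarymxP Pu; have PP' := unitarymx_tr Pu.
have colsE (M : 'M[C]_n) j : (M^t* *m M) j j = (snorm (csd n) (col j M) ^+ 2)%:C.
  rewrite -sdotxx csdE !mxE; apply: eq_bigr => i _; by rewrite !mxE.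
have col_mulE (M N : 'M[C]_n) j : col j (M *m N) = M *m col j N.
  by apply/colP => i; rewrite !mxE; apply: eq_bigr => k _; rewrite mxE.
pose Q := P^t*; pose s j := snorm (csd n) (Z *m col j Q).
have DE : (Z *m Q)^t* *m (Z *m Q) = diag_mx D.
  rewrite trM -mulmxA (mulmxA (Z^t*)) -/A AE /Q trC !mulmxA PP mul1mx.
  by rewrite -mulmxA PP mulmx1.
have Ds j : D 0 j = (s j ^+ 2)%:C.
  by rewrite /s -col_mulE -colsE DE mxE eqxx mulr1n.
have Q1 j : snorm (csd n) (col j Q) = 1.
  have := colsE Q j; rewrite /Q trC PP mxE eqxx => /esym/complexI/eqP.
  by rewrite sqrp_eq1 ?snorm_ge0// => /eqP.
have s1 j : s j <= 1 by rewrite /s (le_trans (Zc _))// Q1.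
have s0 j : 0 < s j.
  rewrite lt_neqAle snorm_ge0 andbT eq_sym; apply/eqP => /csd_eq0 Zq0.
  have /eqP := Q1 j; rewrite -(mulKmx Zu (col j Q)) Zq0 mulmx0 snorm0.
  by rewrite eq_sym oner_eq0.
pose W := Z *m Q *m diag_mx (\row_j (s j)^-1%:C).
have diagJ (e : 'rV[C]_n) : (diag_mx e)^t* = diag_mx (map_mx Num.conj e).
  by rewrite tr_diag_mx map_diag_mx.
have diag1 (e : 'rV[C]_n) : (forall j, e 0 j = 1) -> diag_mx e = 1%:M.
  by move=> e1; rewrite -diag_const_mx; congr diag_mx; apply/rowP => j; rewrite e1 mxE.
have conjR (x : R) : Num.conj x%:C = x%:C by rewrite conjcE conjc_real.
have Wu : W \is unitarymx.
  rewrite -trmxC_unitary; apply/unitarymxP; rewrite trC /W trM.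
  rewrite -mulmxA (mulmxA _ (Z *m Q)) DE diagJ !mulmx_diag; apply: diag1 => j.
  rewrite !mxE Ds conjR -!rmorphM /=; congr (_%:C).
  by have := s0 j; move=> /lt0r_neq0 sn0; field.
pose zeta (e : R) := \row_j (s j +i* (e * Num.sqrt (1 - s j ^+ 2))).
have zetau e : e ^+ 2 = 1 -> W *m diag_mx (zeta e) *m P \is unitarymx.
  move=> e2; apply: (mul_unitarymx _ Pu); apply: (mul_unitarymx Wu).
  apply/unitarymxP; rewrite diagJ mulmx_diag; apply: diag1 => j.
  have ss : Num.sqrt (1 - s j ^+ 2) ^+ 2 = 1 - s j ^+ 2.
    by apply: sqr_sqrtr; rewrite subr_ge0 exprn_ile1// ltW.
  rewrite !mxE mulcJ rnorm_sqr /= exprMn e2 mul1r ss.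
  by rewrite (_ : s j ^+ 2 + (1 - s j ^+ 2) = 1)//; ring.
have ZE : Z = (2^-1)%:C *: (W *m diag_mx (zeta 1) *m P) +
    (1 - 2^-1)%:C *: (W *m diag_mx (zeta (-1)) *m P).
  rewrite (_ : 1 - 2^-1 = 2^-1 :> R); last by field.
  rewrite -scalerDr -mulmxDl -mulmxDr scalemxAl scalemxAr -raddfD -linearZ /=.
  have -> : (2^-1)%:C *: (zeta 1 + zeta (-1)) = \row_j (s j)%:C.
    apply/rowP => j; rewrite !mxE; apply: complex_eq => /=; by field.
  rewrite /W -!mulmxA (mulmxA (diag_mx _) (diag_mx _)) mulmx_diag.
  rewrite (diag1 _ _) ?mul1mx ?PP' ?mulmx1// => j.
  by rewrite !mxE -rmorphM /= mulVf ?lt0r_neq0.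
rewrite ZE; apply: disk_decomposable_convex.
- by rewrite invr_ge0 ler0n invf_le1 ?ler1n.
- by apply/unitarymx_disk_decomposable/zetau; rewrite expr1n.
- by apply/unitarymx_disk_decomposable/zetau; rewrite sqrrN expr1n.
Qed.

(* A singular strict contraction is perturbed to an invertible one, the error
   being a scalar contraction. *)
Lemma contraction_disk_decomposable n (Z : 'M[C]_n) (r : R) : 0 <= r < 1 ->
  (forall z, snorm (csd n) (Z *m z) <= r * snorm (csd n) z) -> disk_decomposable Z.
Proof.
move=> /andP[r0 r1] Zr; pose t := (1 - r) / 2.
have t0 : 0 < t by rewrite divr_gt0// subr_gt0.
have t1 : t <= 1 by rewrite /t; lra.
have [k Zku] : exists k : nat, Z + (t / k.+1%:R)%:C%:M \in unitmx.
  apply: contrapT => /forallNP Znu.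
  pose p := char_poly (- Z); pose x (k : nat) := (t / k.+1%:R)%:C : C.
  have p0 : p != 0 by rewrite monic_neq0// char_poly_monic.
  have rx k : root p (x k).
    rewrite -eigenvalue_root_char; have := Znu k; move/negP.
    rewrite /eigenvalue /eigenspace kermx_eq0 -opprD /row_free eqmx_opp.
    by rewrite -/(row_free _) row_free_unit.
  have : uniq [seq x k | k <- iota 0 (size p)].
    rewrite map_inj_uniq ?iota_uniq// => i j /complexI.
    move=> /(mulfI (lt0r_neq0 t0)) /invr_inj /eqP; rewrite eqr_nat => /eqP [].
    by [].
  move=> /(max_poly_roots p0); rewrite size_map size_iota ltnn => h.
  by apply: notF; apply: h; apply/allP => _ /mapP[k _ ->].
pose e := t / k.+1%:R; have e0 : 0 <= e by rewrite divr_ge0 ?ltW.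
have et : e <= t.
  by rewrite /e ler_pdivrMr// ler_peMr ?ler1n// ltW.
have t1' : 0 < 1 - t by rewrite /t; lra.
have e'E (x : R) : 0 < x -> x * x^-1 = 1 by move=> /lt0r_neq0 /divff.
have -> : Z = t%:C *: (- (e / t))%:C%:M + (1 - t)%:C *: ((1 - t)^-1%:C *: (Z + e%:C%:M)).
  rewrite scalerA -rmorphM /= e'E// scale1r scale_scalar_mx.
  rewrite -rmorphM /= mulrN mulrC divfK ?lt0r_neq0// addrC -addrA -raddfD /= -rmorphD.
  by rewrite /= subrr raddf0 addr0.
apply: disk_decomposable_convex; first by rewrite ltW.
- have [|l [l1 l2 l3]] := @unitarymx_disk_decomposable n 1%:M.
    by apply/unitarymxP; rewrite trmx1 map_mx1 mulmx1.
  exists [seq ((- (e / t))%:C, q.2) | q <- l]; split.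
  + move=> _ /mapP[q _ ->] /=; rewrite rnormC normrN (ger0_norm (divr_ge0 e0 (ltW t0))).
    by rewrite ler_pdivrMr// mul1r.
  + by rewrite big_map /=.
  + by rewrite big_map /= -scaler_sumr l2 scalemx1.
- apply: unit_contraction_disk_decomposable.
    rewrite unitmxZ// unitfE; apply/eqP => -[/eqP].
    by rewrite invr_eq0 gt_eqF.
  move=> z; rewrite -scalemxAl snormZ rnormC ger0_norm ?invr_ge0 ?(ltW t1')//.
  rewrite mulrC ler_pdivrMr// mulmxDl mul_scalar_mx (le_trans (snormD _ _ _))//.
  rewrite snormZ rnormC ger0_norm// (le_trans (lerD (Zr z) (lexx _)))//.
  rewrite -mulrDl mulrC ler_wpM2l ?snorm_ge0//.
  by have := et; rewrite /t; lra.
Qed.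

End ContractiveMatrices.
(** * Unital completely positive maps into matrices *)

Section Ucp.
Variable R : realType.
Local Notation C := R[i].
Local Open Scope sesquilinear_scope.

Section CompletelyPositive.
Variables (H : hilbertType R) (n : nat).
Implicit Types (f g : bop H H -> 'M[C]_n) (T : bop H H).

Definition cpmap f := linear f /\
  forall m (T : 'I_m -> 'I_m -> bop H H), positive_opmx T ->
    positive_mxmx (fun i j => f (T i j)).

Lemma cpmap_ucp f : cpmap f -> f (bid H) = 1%:M ->
  exists2 phi : {linear bop H H -> 'M[C]_n}, ucp phi & phi =1 f.
Proof.
move=> [fl fp] f1; pose L := GRing.isLinear.Build _ _ _ _ f fl.
by exists (HB.pack_for {linear bop H H -> 'M[C]_n} f L).
Qed.

Lemma ucp_cpmap (phi : {linear bop H H -> 'M[C]_n}) : ucp phi -> cpmap phi.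
Proof. by move=> [_ phip]; split=> //; exact: linearP. Qed.

Lemma cpmap0 : cpmap (fun=> 0).
Proof.
split=> [a S T|m T _ x]; first by rewrite scaler0 addr0.
by rewrite sumr_ge0// => i _; rewrite sumr_ge0// => j _; rewrite mulmx0 mul0mx mxE.
Qed.

Lemma cpmapD f g : cpmap f -> cpmap g -> cpmap (fun T => f T + g T).
Proof.
move=> [fl fp] [gl gp]; split=> [a S T|m T Tp x].
  by rewrite fl gl scalerDr addrACA.
apply: le_trans (addr_ge0 (fp _ _ Tp x) (gp _ _ Tp x)) _.
rewrite -big_split /= le_eqVlt; apply/orP; left; apply/eqP.
apply: eq_bigr => i _; rewrite -big_split /=; apply: eq_bigr => j _.
by rewrite mulmxDr mulmxDl [RHS]mxE.
Qed.

Lemma cpmapZ (c : R) f : 0 <= c -> cpmap f -> cpmap (fun T => c%:C *: f T).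
Proof.
move=> c0 [fl fp]; split=> [a S T|m T Tp x].
  by rewrite fl scalerDr !scalerA mulrC.
have c0' : 0 <= c%:C by rewrite ler0c.
apply: le_trans (mulr_ge0 c0' (fp _ _ Tp x)) _.
rewrite mulr_sumr le_eqVlt; apply/orP; left; apply/eqP.
apply: eq_bigr => i _; rewrite mulr_sumr; apply: eq_bigr => j _.
by rewrite -scalemxAr -scalemxAl [RHS]mxE.
Qed.

Lemma cpmap_sum (I : Type) (r : seq I) (P : pred I) (F : I -> bop H H -> 'M[C]_n) :
  (forall i, P i -> cpmap (F i)) -> cpmap (fun T => \sum_(i <- r | P i) F i T).
Proof.
move=> Fp; elim: r => [|i r IHr].
  rewrite (_ : (fun _ => _) = fun=> 0); first exact: cpmap0.
  by apply/funext => T; rewrite big_nil.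
have [Pi|Pi] := boolP (P i); last first.
  rewrite (_ : (fun _ => _) = fun T => \sum_(j <- r | P j) F j T)//.
  by apply/funext => T; rewrite big_cons (negbTE Pi).
rewrite (_ : (fun _ => _) = fun T => F i T + \sum_(j <- r | P j) F j T).
  by apply: cpmapD => //; exact: Fp.
by apply/funext => T; rewrite big_cons Pi.
Qed.

Lemma cpmap_compression (e : 'I_n -> H) :
  cpmap (fun T => \matrix_(l, k) hdot H (T (e k)) (e l)).
Proof.
split=> [a S T|m T Tp x]; first by apply/matrixP => l k; rewrite !mxE hsdE sdotP.
apply: le_trans (Tp (fun i => \sum_k x i k 0 *: e k)) _.
rewrite le_eqVlt; apply/orP; left; apply/eqP.
apply: eq_bigr => i _; apply: eq_bigr => j _.
rewrite hsdE (linear_sum (T i j)) sdot_suml !mxE; apply: eq_bigr => k _.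
rewrite (linearZZ (T i j)) sdotZl mulrC sdot_sumr !mxE; congr (_ * _).
by apply: eq_bigr => l _; rewrite sdotZr !mxE.
Qed.

End CompletelyPositive.

Lemma cpmap_rank1 (H : hilbertType R) n (phi : bop H H -> 'M[C]_1) (q : 'cV[C]_n) : cpmap phi ->
  cpmap (fun T => phi T 0 0 *: (q *m q^t*)).
Proof.
move=> [pl pp]; split=> [a S T|m T Tp x].
  by rewrite pl !mxE scalerDl scalerA.
apply: le_trans (pp _ _ Tp (fun i => q^t* *m x i)) _.
rewrite le_eqVlt; apply/orP; left; apply/eqP.
apply: eq_bigr => i _; apply: eq_bigr => j _.
set c := phi (T i j) 0 0; rewrite (mx11_scalar (phi (T i j))) -/c.
rewrite mul_mx_scalar -scalemxAl -scalemxAr -scalemxAl; congr (fun_of_matrix (_ *: _) 0 0).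
rewrite map_mxM trmx_mul -!mulmxA; congr (_ *m _); congr (_ *m _).
by apply/matrixP => a b; rewrite !mxE; exact: conjCK.
Qed.

Lemma matrix_rangeP n d (u : unitaries R d) (X : 'I_d -> 'M[C]_n) :
  @matrix_range R n d u X <-> exists f : bop (uspace u) (uspace u) -> 'M[C]_n,
    [/\ cpmap f, f (bid _) = 1%:M & forall i, X i = f (u i)].
Proof.
split=> [[phi phiu Xphi]|[f [fp f1 Xf]]].
  by exists phi; split; [exact: ucp_cpmap|case: phiu|].
by have [phi phiu phif] := cpmap_ucp fp f1; exists phi => // i; rewrite phif.
Qed.

(* The disk of radius [delta'] in the [i]-th coordinate axis lies in the first
   matrix range; a decomposition of [Z] over that disk lifts this to level [n]. *)
Lemma axis_matrix_range n d (delta delta' : R) (v : unitaries R d) (i : 'I_d)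
    (Z : 'M[C]_n) : Udelta delta v -> 0 <= delta' < delta -> disk_decomposable Z ->
  exists h : bop (uspace v) (uspace v) -> 'M[C]_n,
    [/\ cpmap h, h (bid _) = 1%:M &
     forall j, h (v j) = if j == i then delta'%:C *: Z else 0].
Proof.
move=> hv /andP[d0 d1] [s [s1 s2 s3]].
have phi_ex (p : C * 'cV[C]_n) : exists phi : bop (uspace v) (uspace v) -> 'M[C]_1,
    rnorm p.1 <= 1 -> [/\ cpmap phi, phi (bid _) = 1%:M &
      forall j, phi (v j) 0 0 = if j == i then delta'%:C * p.1 else 0].
  have [p1|] := boolP (rnorm p.1 <= 1); last by exists (fun=> 0).
  pose z : 'cV[C]_d := \col_j if j == i then delta'%:C * p.1 else 0.
  have : l2norm z < delta.
    apply: le_lt_trans d1; rewrite /l2norm (bigD1 i)//= big1 ?addr0.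
      have zi : rnorm (z i 0) = delta' * rnorm p.1.
        by rewrite mxE eqxx rnormM rnormC ger0_norm.
      rewrite [X in X ^+ 2]zi sqrtr_sqr ger0_norm ?ler_piMr//.
      by rewrite mulr_ge0 ?rnorm_ge0.
    move=> j ji; rewrite [X in X ^+ 2](_ : _ = 0) ?expr0n//.
    by rewrite -[LHS]/(rnorm (z j 0)) mxE (negbTE ji) rnorm0.
  move=> /hv /matrix_rangeP[phi [php ph1 phz]]; exists phi => _; split=> // j.
  by rewrite -phz !mxE eqxx mulr1n.
have [phi phiP] := choice phi_ex.
exists (fun T => \sum_(p <- s | p \in s) phi p T 0 0 *: (p.2 *m p.2^t*)); split.
- by apply: cpmap_sum => p /s1 /phiP[php _ _]; exact: cpmap_rank1.
- rewrite -s2 [RHS]big_seq_cond; under [RHS]eq_bigl do rewrite andbT.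
  apply: eq_bigr => p /s1 /phiP[_ -> _].
  by rewrite mxE eqxx scale1r.
- move=> j; under eq_bigr => p /s1 /phiP[_ _ ->] do [].
  case: ifP => ji; last by rewrite big1// => p _; rewrite scale0r.
  rewrite s3 scaler_sumr [RHS]big_seq_cond; under [RHS]eq_bigl do rewrite andbT.
  by apply: eq_bigr => p _; rewrite scalerA.
Qed.

Lemma matrix_range_scaled n d (delta r r' : R) (v : unitaries R d)
    (X Y : 'I_d -> 'M[C]_n) :
  0 < delta -> 0 <= r' < r -> Udelta delta v -> @matrix_range R n d v Y ->
  (forall i z, snorm (csd R n) ((X i - Y i) *m z) <= r' * snorm (csd R n) z) ->
  exists g : bop (uspace v) (uspace v) -> 'M[C]_n,
    [/\ cpmap g, g (bid _) = 1%:M &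
     forall i, X i = (1 + d%:R * r / delta)%:C *: g (v i)].
Proof.
move=> d0 /andP[r'0 r'r] hv /matrix_rangeP[f [fp f1 Yf]] XY.
have [s /andP[r's sr]] : exists s, r' < s < r by exists ((r' + r) / 2); lra.
have s0 : 0 < s by lra.
have r0 : 0 < r by lra.
pose delta' := delta * (s / r).
have hdelta' : 0 <= delta' < delta.
  rewrite mulr_ge0 ?divr_ge0 ?(ltW d0) ?(ltW s0) ?(ltW r0)//=.
  by rewrite gtr_pMr// ltr_pdivrMr// mul1r.
have Zd i : disk_decomposable (s^-1%:C *: (X i - Y i)).
  apply: (@contraction_disk_decomposable _ _ _ (r' / s)).
    by rewrite divr_ge0 ?(ltW s0)//= ltr_pdivrMr// mul1r.
  move=> z; rewrite -scalemxAl snormZ rnormC ger0_norm ?invr_ge0 ?(ltW s0)//.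
  by rewrite mulrAC mulrC ler_wpM2r ?invr_ge0 ?(ltW s0).
have hex i := axis_matrix_range i hv hdelta' (Zd i).
have [h hP] := choice hex.
set c := 1 + d%:R * r / delta.
have c0 : 0 < c by rewrite ltr_pwDl// divr_ge0 ?mulr_ge0 ?(ltW d0) ?(ltW r0).
exists (fun T => c^-1%:C *: f T + (r / (delta * c))%:C *: \sum_i h i T); split.
- apply: cpmapD; first by apply: cpmapZ; rewrite ?invr_ge0 ?(ltW c0).
  apply: cpmapZ; first by rewrite divr_ge0 ?(ltW r0)// mulr_ge0 ?(ltW d0) ?(ltW c0).
  by apply: cpmap_sum => i _; have [] := hP i.
- under eq_bigr => i _ do have [_ -> _] := hP i.
  rewrite f1 sumr_const card_ord -scaler_nat scalerA -scalerDl.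
  rewrite (_ : _ + _ = 1) ?scale1r//.
  have -> : (d%:R : C) = (d%:R)%:C by rewrite rmorph_nat.
  rewrite -rmorphM -rmorphD /= (_ : _ + _ = 1)// /c.
  have : delta + d%:R * r != 0 by rewrite gt_eqF// ltr_pwDl// mulr_ge0// ltW.
  by move=> nz; field; rewrite nz gt_eqF.
- move=> j; rewrite (bigD1 j)//= big1 ?addr0; last first.
    by move=> i ij; have [_ _ ->] := hP i; rewrite eq_sym (negbTE ij).
  have [_ _ ->] := hP j; rewrite eqxx scalerDr -Yf !scalerA -!rmorphM /=.
  rewrite divff ?gt_eqF// scale1r (_ : _ * s^-1 = 1).
    by rewrite scale1r addrC subrK.
  rewrite (_ : c * (r / (delta * c)) * delta' * s^-1 = 1)// /delta'.
  have := lt0r_neq0 c0; move: (c) => c' c'0.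
  by field; rewrite c'0 !gt_eqF.
Qed.

End Ucp.

(** * Separability and orthonormal sequences *)

Section Separable.
Variables (R : realType) (H : hilbertType R).

Lemma separable_seq : separable H ->
  exists x : nat -> H, forall h (e : R), 0 < e -> exists n, rnorm (h - x n) <= e.
Proof.
move=> [D /countable_injP[f finj] Ddense].
pose x n := xget 0 [set y | D y /\ f y = n]; exists x => h e e0.
have e0C : 0 < e%:C by rewrite ltcR.
have [|d [hd Dd]] := Ddense (ball h e%:C) _ (ball_open h e%:C).
  by exists h; exact: ballxx.
exists (f d); have -> : x (f d) = d.
  have [|Dx fx] := @xgetPex _ 0 [set y | D y /\ f y = f d].
    by exists d.
  by apply: finj; rewrite ?inE.
by move: hd; rewrite -ball_normE /= -lt_rnorm_norm => /ltW.
Qed.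

Lemma separable_range (T : countType) (x : T -> H) :
  (forall h (e : R), 0 < e -> exists t, rnorm (h - x t) <= e) -> separable H.
Proof.
move=> xd; exists (range x); first exact: card_le_trans (card_image_le _ _) (countableP _).
move=> O [h Oh] Oo; have : nbhs h O by apply: open_nbhs_nbhs.
move=> /nbhs_ballP[e /= e0 heO].
have eR : e = (complex.Re e)%:C by apply/ge0_ReC/ltW.
have e'0 : 0 < complex.Re e by rewrite -ltcR -eR.
have [t ht] := xd h (complex.Re e / 2) (divr_gt0 e'0 (ltr0Sn _ 1)).
exists (x t); split; last by exists t.
apply: heO; rewrite -ball_normE /= eR -lt_rnorm_norm (le_lt_trans ht)//.
by rewrite gtr_pMr// invf_lt1// ltr1n.
Qed.

Section Proj.
Variable e : nat -> H.

Definition proj n (h : H) := \sum_(k < n) hdot H h (e k) *: e k.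

Lemma hdot_projl n h y :
  hdot H (proj n h) y = \sum_(k < n) hdot H h (e k) * hdot H (e k) y.
Proof. by rewrite hsdE sdot_suml; apply: eq_bigr => k _; rewrite sdotZl. Qed.

Hypothesis e_orth : forall i j, i != j -> hdot H (e i) (e j) = 0.
Hypothesis e_norm : forall i, e i = 0 \/ rnorm (e i) = 1.

Lemma hdot_proj_basis n h (j : 'I_n) : hdot H (proj n h) (e j) = hdot H h (e j).
Proof.
rewrite hdot_projl (bigD1 j)//= big1 ?addr0 => [|k kj].
  have [->|e1] := e_norm j; first by rewrite !hsdE !sdot0r mulr0.
  by rewrite hdotxx e1 expr1n mulr1.
by rewrite e_orth ?mulr0.
Qed.

Lemma proj_pythagoras n h (a : 'I_n -> R[i]) :
  rnorm (h - \sum_k a k *: e k) ^+ 2 =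
  rnorm (h - proj n h) ^+ 2 + rnorm (proj n h - \sum_k a k *: e k) ^+ 2.
Proof.
rewrite -!snorm_hsd -(subrKA (proj n h)) snorm_sqrD.
suff -> : hsd H (h - proj n h) (proj n h - \sum_k a k *: e k) = 0.
  by rewrite mulr0 addr0.
have ho (b : 'I_n -> R[i]) : hsd H (h - proj n h) (\sum_k b k *: e k) = 0.
  rewrite sdot_sumr big1// => k _.
  by rewrite sdotZr sdotBl -!hsdE hdot_proj_basis subrr mulr0.
by rewrite sdotBr [X in X - _]ho ho subrr.
Qed.

Lemma proj_best n h (a : 'I_n -> R[i]) :
  rnorm (h - proj n h) <= rnorm (h - \sum_k a k *: e k).
Proof.
rewrite -(@ler_pXn2r _ 2) ?nnegrE ?rnorm_ge0//.
by rewrite (proj_pythagoras h a) lerDl sqr_ge0.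
Qed.

Lemma rnorm_proj_le n h : rnorm (proj n h) <= rnorm h.
Proof.
rewrite -(@ler_pXn2r _ 2) ?nnegrE ?rnorm_ge0//.
have := @proj_pythagoras n h (fun=> 0).
rewrite big1 => [|k _]; last by rewrite scale0r.
by rewrite !subr0 => ->; rewrite lerDr sqr_ge0.
Qed.

End Proj.

Definition normalize (y : H) : H := (rnorm y)^-1%:C *: y.

(* [gram_schmidt x n k] is the [k]-th vector for [k < n]. A linearly dependent
   [x k] yields the zero vector. *)
Fixpoint gram_schmidt (x : nat -> H) n : nat -> H :=
  if n is m.+1 then fun k =>
    if k == m then normalize (x m - proj (gram_schmidt x m) m (x m))
    else gram_schmidt x m k
  else fun=> 0.

Lemma orthonormal_seq : separable H -> exists e : nat -> H,
  [/\ forall i j, i != j -> hdot H (e i) (e j) = 0,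
      forall i, e i = 0 \/ rnorm (e i) = 1 &
      forall h (eps : R), 0 < eps ->
        exists N, forall n, (N <= n)%N -> rnorm (h - proj e n h) <= eps].
Proof.
move=> /separable_seq[x xd]; pose e k := gram_schmidt x k.+1 k.
have gsE n k : (k < n)%N -> gram_schmidt x n k = e k.
  elim: n => // n IHn; rewrite ltnS leq_eqVlt => /orP[/eqP ->//|kn] /=.
  by rewrite (ltn_eqF kn) IHn.
pose y n := x n - proj e n (x n).
have eE n : e n = normalize (y n).
  rewrite /e /= eqxx; congr normalize; congr (_ - _); apply: eq_bigr => k _.
  by rewrite gsE.
have e_norm i : e i = 0 \/ rnorm (e i) = 1.
  rewrite eE /normalize; have [->|yn] := eqVneq (y i) 0; first by left; rewrite scaler0.
  right; rewrite rnormZ rnormC ger0_norm ?invr_ge0 ?rnorm_ge0// mulVf//.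
  by apply: contra yn => /eqP/rnorm0_eq0 ->.
have yE n : y n = (rnorm (y n))%:C *: e n.
  rewrite eE /normalize scalerA -rmorphM /=.
  have [y0|yn] := eqVneq (rnorm (y n)) 0; last by rewrite divff// scale1r.
  by rewrite (rnorm0_eq0 y0) rnorm0 mul0r scale0r.
have e_orth_lt n : forall i j, (i < n)%N -> (j < n)%N -> i != j ->
    hdot H (e i) (e j) = 0.
  elim: n => // n IHn.
  have yo k : (k < n)%N -> hdot H (y n) (e k) = 0.
    pose e' k := if (k < n)%N then e k else 0.
    have e'E (l : 'I_n) : e' l = e l by rewrite /e' ltn_ord.
    have -> : y n = x n - proj e' n (x n).
      by congr (_ - _); apply: eq_bigr => l _; rewrite e'E.
    move=> kn; rewrite -(e'E (Ordinal kn)) hsdE sdotBl -!hsdE hdot_proj_basis ?subrr//.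
      move=> i j ij; rewrite /e'; case: ifP => [lin|_]; last by rewrite hsdE sdot0l.
      case: ifP => [ljn|_]; last by rewrite hsdE sdot0r.
      exact: IHn.
    by move=> l; rewrite /e'; case: ifP => _; [exact: e_norm|left].
  have eno k : (k < n)%N -> hdot H (e n) (e k) = 0.
    by move=> kn; rewrite eE hsdE sdotZl -hsdE yo// mulr0.
  move=> i j; rewrite !ltnS [(i <= n)%N]leq_eqVlt [(j <= n)%N]leq_eqVlt.
  move=> /orP[/eqP ->|lin] /orP[/eqP ->|ljn].
  - by rewrite eqxx.
  - by move=> _; exact: eno.
  - by move=> _; rewrite hsdE (sdotC _ (e n)) -hsdE eno// rmorph0.
  - exact: IHn.
have e_orth i j : i != j -> hdot H (e i) (e j) = 0.
  by apply: (e_orth_lt (maxn i j).+1); rewrite ltnS ?leq_maxl ?leq_maxr.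
have xE m n : (m < n)%N -> exists a : 'I_n -> R[i], x m = \sum_k a k *: e k.
  move=> mn; exists (fun k => if (k < m)%N then hdot H (x m) (e k)
    else if k == m :> nat then (rnorm (y m))%:C else 0).
  pose F k := (if (k < m)%N then hdot H (x m) (e k)
    else if k == m then (rnorm (y m))%:C else 0) *: e k.
  rewrite -(big_mkord xpredT F) (big_cat_nat _ (n := m.+1))//=.
  have -> : \sum_(m.+1 <= k < n) F k = 0.
    rewrite big_nat_cond big1// => k /andP[/andP[mk _] _].
    by rewrite /F ltnNge (ltnW mk)/= gtn_eqF// scale0r.
  rewrite addr0.
  rewrite big_nat_recr//= {2}/F ltnn eqxx -yE big_mkord.
  rewrite (eq_bigr (fun k : 'I_m => hdot H (x m) (e k) *: e k)) => [|k _].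
    by rewrite addrC subrK.
  by rewrite /F ltn_ord.
exists e; split=> // h eps eps0; have [m hm] := xd h eps eps0; exists m.+1 => n mn.
by have [a xa] := xE m n mn; rewrite (le_trans (proj_best e_orth e_norm h a))// -xa.
Qed.

End Separable.

(** * Ultralimits of bounded sequences *)

Section Ultralimit.
Variables (R : realType) (U : set_system nat).
Hypotheses (UU : UltraFilter U) (Uoo : \oo `<=` U).

Let ultralimit_real (g : nat -> R) (M : R) : (forall n, `|g n| <= M) ->
  exists l : R, forall e, 0 < e -> U [set n | `|g n - l| <= e].
Proof.
move=> gM; pose S := [set t : R | U [set n | t <= g n]].
have S0 : has_sup S.
  split.
    exists (- M); rewrite /S /= (_ : [set _ | _] = setT); first exact: filterT.
    by apply/seteqP; split=> // n _ /=; have := gM n; rewrite ler_norml => /andP[].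
  exists M => t /filter_ex[n /= /le_trans]; apply.
  by rewrite (le_trans (ler_norm _)).
exists (sup S) => e e0.
have [t St lt] := sup_adherent e0 S0.
have nS : ~ S (sup S + e).
  by move=> /(sup_upper_bound S0); rewrite gerDl leNgt e0.
have [//|Uc] := in_ultra_setVsetC [set n | sup S + e <= g n] UU.
apply: filterS (filterI St Uc) => n /= [tn /negP]; rewrite -ltNge => gn.
rewrite ler_norml; apply/andP; split; lra.
Qed.

Lemma ultralimit_ex (a : nat -> R[i]) (M : R) : (forall n, rnorm (a n) <= M) ->
  exists l, forall e : R, 0 < e -> U [set n | rnorm (a n - l) <= e].
Proof.
move=> aM.
have [|p pl] := @ultralimit_real (fun n => complex.Re (a n)) M.
  by move=> n; rewrite (le_trans (normr_Re_le _)).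
have [|q ql] := @ultralimit_real (fun n => complex.Im (a n)) M.
  by move=> n; rewrite (le_trans (normr_Im_le _)).
exists (p +i* q) => e e0; have e2 : 0 < e / 2 by rewrite divr_gt0.
apply: filterS (filterI (pl _ e2) (ql _ e2)) => n [pn qn] /=.
rewrite (le_trans (rnorm_le_ReIm _))// ReD ReN ImD ImN /=.
by rewrite [leRHS](splitr e) lerD.
Qed.

Definition ulim (a : nat -> R[i]) : R[i] :=
  xget 0 [set l | forall e : R, 0 < e -> U [set n | rnorm (a n - l) <= e]].

Definition bounded_seq (a : nat -> R[i]) := exists M : R, forall n, rnorm (a n) <= M.

Lemma ulimP a : bounded_seq a ->
  forall e : R, 0 < e -> U [set n | rnorm (a n - ulim a) <= e].
Proof. by move=> [M /ultralimit_ex aM]; exact: (xgetPex 0 aM). Qed.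

Lemma ulim_unique a l :
  (forall e : R, 0 < e -> U [set n | rnorm (a n - l) <= e]) -> ulim a = l.
Proof.
move=> al; have al' : forall e : R, 0 < e -> U [set n | rnorm (a n - ulim a) <= e].
  by apply: (xgetPex 0 (P := [set l | forall e : R, 0 < e ->
    U [set n | rnorm (a n - l) <= e]])); exists l.
apply/eqP; rewrite -subr_eq0; apply/eqP; apply: (@rnorm_eps _ _ _ 2) => e e0.
have [n [/= h1 h2]] := filter_ex (filterI (al _ e0) (al' _ e0)).
rewrite (le_trans (rnorm_dist _ _ (a n)))// mulr2n mulrDl mul1r lerD//.
by rewrite rnorm_distC.
Qed.

Lemma ulim_cvg a l : (forall e : R, 0 < e ->
  exists N, forall n, (N <= n)%N -> rnorm (a n - l) <= e) -> ulim a = l.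
Proof.
move=> al; apply: ulim_unique => e e0; have [N Ne] := al e e0.
by apply: Uoo; exists N.
Qed.

Lemma ulimPl (c : R[i]) a b : bounded_seq a -> bounded_seq b ->
  ulim (fun n => c * a n + b n) = c * ulim a + ulim b.
Proof.
move=> aM bM; apply: ulim_unique => e e0.
have e2 : 0 < e / 2 by rewrite divr_gt0.
have ec : 0 < e / 2 / (rnorm c + 1).
  by rewrite divr_gt0// ltr_wpDl// rnorm_ge0.
apply: filterS (filterI (ulimP aM ec) (ulimP bM e2)) => n [/= an bn].
have -> : c * a n + b n - (c * ulim a + ulim b) =
  c * (a n - ulim a) + (b n - ulim b) by ring.
rewrite (le_trans (rnormD _ _))// (splitr e) lerD// rnormM.
rewrite (le_trans (ler_wpM2l (rnorm_ge0 _) an))// [leLHS]mulrCA ger_pMr//.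
by rewrite ler_pdivrMr ?ltr_wpDl ?rnorm_ge0// mul1r lerDl.
Qed.

Lemma ulim_conj a : bounded_seq a ->
  ulim (fun n => Num.conj (a n)) = Num.conj (ulim a).
Proof.
move=> aM; apply: ulim_unique => e e0; apply: filterS (ulimP aM e0) => n /=.
by rewrite -rmorphB rnorm_conj.
Qed.

Lemma ulim_ge0 a : bounded_seq a -> (forall n, 0 <= a n) -> 0 <= ulim a.
Proof.
move=> aM a0; rewrite lecE.
have h e : 0 < e -> `|complex.Im (ulim a)| <= e /\ - complex.Re (ulim a) <= e.
  move=> e0; have [n /= an] := filter_ex (ulimP aM e0).
  have := le_trans (normr_Re_le _) an; have := le_trans (normr_Im_le _) an.
  rewrite ImD ImN ReD ReN (ger0_Im (a0 n)) add0r normrN => -> h; split=> //.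
  have := ge0_Re (a0 n); move: h; rewrite ler_norml => /andP[]; lra.
apply/andP; split.
  rewrite /= -normr_le0; apply/ler_addgt0Pr => e e0; rewrite add0r.
  by have [] := h e e0.
rewrite /= -oppr_le0; apply/ler_addgt0Pr => e e0; rewrite add0r.
by have [] := h e e0.
Qed.

Lemma bounded_seq_cst (c : R[i]) : bounded_seq (fun=> c).
Proof. by exists (rnorm c). Qed.

Lemma ulim_cst (c : R[i]) : ulim (fun=> c) = c.
Proof. by apply: ulim_cvg => e e0; exists 0 => n _; rewrite subrr rnorm0 ltW. Qed.

Lemma ulim_le a b (c : R[i]) : bounded_seq a -> bounded_seq b ->
  (forall n, a n <= c * b n) -> ulim a <= c * ulim b.
Proof.
move=> aM bM ab; have b0 := bounded_seq_cst 0.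
have aM' : bounded_seq (fun n => -1 * a n + 0).
  by have [M aM'] := aM; exists M => n; rewrite addr0 mulN1r rnormN.
have e1 := ulimPl (-1) aM b0; have e2 := ulimPl c bM aM'.
have : 0 <= ulim (fun n => c * b n + (-1 * a n + 0)).
  apply: ulim_ge0 => [|n]; last by rewrite addr0 mulN1r subr_ge0.
  have [M aM''] := aM'; have [N bN] := bM; exists (rnorm c * N + M) => n.
  by rewrite (le_trans (rnormD _ _))// lerD// rnormM ler_wpM2l ?rnorm_ge0.
by rewrite e2 e1 ulim_cst addr0 mulN1r subr_ge0.
Qed.

Section UltraSemidot.
Variables (A E : lmodType R[i]) (b : nat -> semidot A) (j : {linear E -> A}).
Hypothesis b_bounded : forall x, exists M : R, forall n, snorm (b n) (j x) <= M.

Let usdot (x y : E) := ulim (fun n => b n (j x) (j y)).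

Lemma bounded_seq_sdot x y : bounded_seq (fun n => b n (j x) (j y)).
Proof.
have [M xM] := b_bounded x; have [N yN] := b_bounded y; exists (M * N) => n.
by rewrite (le_trans (sdot_CauchySchwarz _ _ _))// ler_pM ?snorm_ge0.
Qed.

Let usdotP a x y z : usdot (a *: x + y) z = a * usdot x z + usdot y z.
Proof.
rewrite /usdot -ulimPl; try exact: bounded_seq_sdot.
by congr ulim; apply/funext => n; rewrite linearP sdotP.
Qed.

Let usdotC x y : usdot y x = Num.conj (usdot x y).
Proof.
rewrite /usdot -ulim_conj; last exact: bounded_seq_sdot.
by congr ulim; apply/funext => n; rewrite -sdotC.
Qed.

Let usdotxx_ge0 x : 0 <= usdot x x.
Proof.
by apply: ulim_ge0 => [|n]; [exact: bounded_seq_sdot|exact: sdotxx_ge0].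
Qed.

Definition usd : semidot E := Semidot usdotP usdotC usdotxx_ge0.

Lemma usdE x y : usd x y = ulim (fun n => b n (j x) (j y)).
Proof. by []. Qed.

Lemma snorm_usd_le x (M : R) : 0 <= M ->
  (forall n, snorm (b n) (j x) <= M) -> snorm usd x <= M.
Proof.
move=> M0 xM; rewrite -(@ler_pXn2r _ 2) ?nnegrE ?snorm_ge0// -lecR -sdotxx usdE.
have := @ulim_le (fun n => b n (j x) (j x)) (fun=> 1) (M ^+ 2)%:C.
rewrite ulim_cst mulr1; apply; [exact: bounded_seq_sdot|exact: bounded_seq_cst|move=> n].
by rewrite /= sdotxx lecR ler_pXn2r ?nnegrE ?snorm_ge0.
Qed.

Lemma snorm_usd_leM x y (M : R) : 0 <= M ->
  (forall n, snorm (b n) (j x) <= M * snorm (b n) (j y)) ->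
  snorm usd x <= M * snorm usd y.
Proof.
move=> M0 xM; rewrite -(@ler_pXn2r _ 2) ?nnegrE ?mulr_ge0 ?snorm_ge0//.
rewrite exprMn -lecR [leRHS]rmorphM /= -!sdotxx !usdE.
apply: ulim_le; [exact: bounded_seq_sdot|exact: bounded_seq_sdot|move=> n].
by rewrite !sdotxx -rmorphM lecR -exprMn ler_pXn2r ?nnegrE ?mulr_ge0 ?snorm_ge0.
Qed.

End UltraSemidot.

End Ultralimit.

Section SemidotProd.
Variables (R : realType) (E F : lmodType R[i]) (b : semidot E) (c : semidot F).

Let pdot (x y : E * F) := b x.1 y.1 + c x.2 y.2.

Let pdotP a x y z : pdot (a *: x + y) z = a * pdot x z + pdot y z.
Proof. by rewrite /pdot /= !sdotP mulrDr addrACA. Qed.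

Let pdotC x y : pdot y x = Num.conj (pdot x y).
Proof. by rewrite /pdot rmorphD /= -!sdotC. Qed.

Let pdotxx_ge0 x : 0 <= pdot x x.
Proof. by rewrite addr_ge0 ?sdotxx_ge0. Qed.

Definition psd : semidot (E * F)%type := Semidot pdotP pdotC pdotxx_ge0.

Lemma psdE x y : psd x y = b x.1 y.1 + c x.2 y.2.
Proof. by []. Qed.

Lemma snorm_psd x : snorm psd x ^+ 2 = snorm b x.1 ^+ 2 + snorm c x.2 ^+ 2.
Proof. by apply: complexI; rewrite rmorphD /= -!sdotxx psdE. Qed.

Lemma snorm_psd_le x : snorm psd x <= snorm b x.1 + snorm c x.2.
Proof.
rewrite -(@ler_pXn2r _ 2) ?nnegrE ?addr_ge0 ?snorm_ge0// snorm_psd sqrrD.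
by rewrite lerD2r lerDl mulrn_wge0 ?mulr_ge0 ?snorm_ge0.
Qed.

Lemma snorm_psd_leM x y (M : R) : 0 <= M ->
  snorm b x.1 <= M * snorm b y.1 -> snorm c x.2 <= M * snorm c y.2 ->
  snorm psd x <= M * snorm psd y.
Proof.
move=> M0 h1 h2; rewrite -(@ler_pXn2r _ 2) ?nnegrE ?mulr_ge0 ?snorm_ge0//.
rewrite exprMn !snorm_psd mulrDr -!exprMn.
by rewrite lerD// ler_pXn2r ?nnegrE ?mulr_ge0 ?snorm_ge0.
Qed.

End SemidotProd.

Section AntidualLift.
Variables (R : realType) (E : lmodType R[i]) (b : semidot E).
Variables (T : E -> E) (M : R).
Hypotheses (T_linear : linear T) (M_ge0 : 0 <= M).
Hypothesis T_bounded : forall x, snorm b (T x) <= M * snorm b x.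

Lemma antidual_precomp_subproof (f : antidual b) : f \o T \in antifunctional b.
Proof.
apply/asboolP; split; first by move=> a x y; rewrite /= T_linear antidualP.
have [N N0 fN] := antidual_bounded f; exists (N * M); first exact: mulr_ge0.
by move=> x; rewrite (le_trans (fN _))// -mulrA ler_wpM2l.
Qed.

Definition antidual_precomp (f : antidual b) : antidual b :=
  Antidual (antidual_precomp_subproof f).

Lemma dnorm_antidual_precomp f : dnorm (antidual_precomp f) <= M * dnorm f.
Proof.
apply: dnorm_le => [|x]; first by rewrite mulr_ge0 ?dnorm_ge0.
rewrite /= (le_trans (le_dnorm _ _))// -mulrA mulrCA.
by rewrite ler_wpM2l ?dnorm_ge0.
Qed.

Lemma antidual_precomp_linear : linear antidual_precomp.
Proof. by move=> a f g; apply: val_inj; apply/funext. Qed.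

Lemma antidual_precomp_bounded : exists N : R, forall f : antidual_hilbert b,
  rnorm (antidual_precomp f : antidual_hilbert b) <= N * rnorm f.
Proof. by exists M => f; exact: dnorm_antidual_precomp. Qed.

Definition bop_precomp : bop (antidual_hilbert b) (antidual_hilbert b) :=
  @mkbop R (antidual_hilbert b) (antidual_hilbert b) antidual_precomp
    antidual_precomp_linear antidual_precomp_bounded.

End AntidualLift.

Lemma antidual_eq (R : realType) (E : lmodType R[i]) (b : semidot E)
  (f g : antidual b) : (forall x, f x = g x) -> f = g.
Proof. by move=> fg; apply: val_inj; apply/funext. Qed.

Lemma antidualD (R : realType) (E : lmodType R[i]) (b : semidot E)
  (f : antidual b) x y : f (x + y) = f x + f y.
Proof. by rewrite -{1}[x]scale1r antidualP rmorph1 mul1r. Qed.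

Lemma antidual0 (R : realType) (E : lmodType R[i]) (b : semidot E)
  (f : antidual b) : f 0 = 0.
Proof. by apply: (addIr (f 0)); rewrite -antidualD !add0r. Qed.

Lemma hdot_antidual (R : realType) (E : lmodType R[i]) (b : semidot E)
  (f : antidual_hilbert b) x :
  hdot (antidual_hilbert b) f (adinj b x) = (f : antidual b) x.
Proof. exact: addot_inj. Qed.

(* The form of the Stinespring construction of [Phi], in coordinates: a
   sequence [xi] stands for [sum_k xi_k (x) e_k]. *)
Section StageForm.
Variables (R : realType) (H : hilbertType R) (n : nat).
Variable Phi : bop H H -> 'M[R[i]]_n.
Hypothesis Phi_cp : cpmap Phi.

Lemma stage_positive (D : bop H H) (xi : nat -> bop H H) :
  (forall x, 0 <= hdot H (D x) x) ->
  0 <= \sum_(k < n) \sum_(l < n) Phi (bcomp (adj (xi l)) (bcomp D (xi k))) l k.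
Proof.
move=> D0; pose T (i j : 'I_n) := bcomp (adj (xi i)) (bcomp D (xi j)).
have Tp : positive_opmx T.
  move=> x; rewrite (_ : \sum_i _ = hdot H (D (\sum_(j < n) xi j (x j)))
    (\sum_(i < n) xi i (x i))).
    exact: D0.
  rewrite hsdE sdot_sumr; apply: eq_bigr => i _.
  rewrite (linear_sum D) sdot_suml; apply: eq_bigr => j _.
  by rewrite /= hdot_adjl.
have := Phi_cp.2 _ _ Tp (fun i => delta_mx i 0).
congr (_ <= _); rewrite exchange_big /=; apply: eq_bigr => i _.
apply: eq_bigr => j _; rewrite map_delta_mx trmx_delta.
by rewrite -rowE -colE !mxE.
Qed.

Let sdt (xi eta : nat -> bop H H) :=
  \sum_(k < n) \sum_(l < n) Phi (bcomp (adj (eta l)) (xi k)) l k.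

Let sdtP a x y z : sdt (a *: x + y) z = a * sdt x z + sdt y z.
Proof.
rewrite /sdt mulr_sumr -big_split /=; apply: eq_bigr => k _.
rewrite mulr_sumr -big_split /=; apply: eq_bigr => l _.
by rewrite bcompPr Phi_cp.1 !mxE.
Qed.

Let sdtPr a x y z : sdt z (a *: x + y) = Num.conj a * sdt z x + sdt z y.
Proof.
rewrite /sdt mulr_sumr -big_split /=; apply: eq_bigr => k _.
rewrite mulr_sumr -big_split /=; apply: eq_bigr => l _.
by rewrite adjPl bcompPl Phi_cp.1 !mxE.
Qed.

Let sdtxx_ge0 x : 0 <= sdt x x.
Proof.
have := @stage_positive (bid H) x (fun y => sdotxx_ge0 (hsd H) y).
congr (_ <= _); apply: eq_bigr => k _; apply: eq_bigr => l _.
by rewrite bcomp1l.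
Qed.

Definition stage : semidot (nat -> bop H H) :=
  Semidot sdtP (positive_sesquilinear_sym sdtP sdtPr sdtxx_ge0) sdtxx_ge0.

Lemma stageE xi eta : stage xi eta =
  \sum_(k < n) \sum_(l < n) Phi (bcomp (adj (eta l)) (xi k)) l k.
Proof. by []. Qed.

Definition lmul (S : bop H H) (xi : nat -> bop H H) : nat -> bop H H :=
  fun k => bcomp S (xi k).

Lemma stage_adj S xi eta : stage (lmul S xi) eta = stage xi (lmul (adj S) eta).
Proof.
apply: eq_bigr => k _; apply: eq_bigr => l _.
by rewrite adj_comp adjK bcompA.
Qed.

Lemma snorm_stage_lmul (S : bop H H) (M : R) xi : 0 <= M ->
  (forall x, rnorm (S x) <= M * rnorm x) ->
  snorm stage (lmul S xi) <= M * snorm stage xi.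
Proof.
move=> M0 SM; rewrite -(@ler_pXn2r _ 2) ?nnegrE ?mulr_ge0 ?snorm_ge0//.
rewrite exprMn -lecR [leRHS]rmorphM /= -!sdotxx -subr_ge0.
pose D := (M ^+ 2)%:C *: bid H - bcomp (adj S) S.
have D0 x : 0 <= hdot H (D x) x.
  rewrite bopB bopZ hsdE sdotBl sdotZl -!hsdE /= hdot_adjl !hdotxx -rmorphM -rmorphB.
  by rewrite ler0c subr_ge0 -exprMn ler_pXn2r ?nnegrE ?mulr_ge0 ?rnorm_ge0.
have := stage_positive xi D0; congr (_ <= _).
rewrite !stageE mulr_sumr -sumrB; apply: eq_bigr => k _.
rewrite mulr_sumr -sumrB; apply: eq_bigr => l _.
rewrite (_ : bcomp _ (bcomp D _) = (M ^+ 2)%:C *: bcomp (adj (xi l)) (xi k)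
  + -1 *: bcomp (adj (lmul S xi l)) (lmul S xi k)).
  rewrite Phi_cp.1 -[_ *: bcomp (adj (lmul _ _ _)) _]addr0 Phi_cp.1.
  rewrite -[X in _ + (_ + X)](_ : 0 = Phi 0) ?addr0 ?scaleN1r ?mxE//.
  by apply: (addIr (Phi 0)); rewrite add0r -{1}[0]addr0 -{1}[0](scale1r 0) Phi_cp.1 scale1r.
apply: bop_eq => x; rewrite bopD !bopZ /lmul adj_comp.
have DE y : D y = (M ^+ 2)%:C *: y - adj S (S y) by [].
rewrite [LHS](_ : _ = adj (xi l) (D (xi k x)))// DE.
by rewrite linearB linearZZ scaleN1r.
Qed.

End StageForm.

(** * The dilation *)

Lemma linear_fun0 (R : pzRingType) (V W : lmodType R) (f : V -> W) :
  linear f -> f 0 = 0.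
Proof.
by move=> fl; apply: (addIr (f 0)); rewrite -{1}[f 0]scale1r -fl scaler0 !add0r.
Qed.

Lemma linear_funZ (R : pzRingType) (V W : lmodType R) (f : V -> W) a x :
  linear f -> f (a *: x) = a *: f x.
Proof. by move=> fl; rewrite -[a *: x]addr0 fl linear_fun0// addr0. Qed.

Lemma cstar_generated_subalgebra (R : realType) d (u : unitaries R d) :
  cstar_subalgebra (@cstar_generated R d u).
Proof.
split.
- split=> [A hA|S T Su Tu A hA]; have [[[A0 AD] AZ AM Aadj Acl] _] := hA => //.
  by apply: AD; [exact: Su|exact: Tu].
- by move=> a S Su A hA; have [[_ AZ _ _ _] _] := hA; apply: AZ; exact: Su.
- move=> S T Su Tu A hA; have [[_ _ AM _ _] _] := hA.
  by apply: AM; [exact: Su|exact: Tu].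
- by move=> S T Su ST A hA; have [[_ _ _ Aadj _] _] := hA; apply: Aadj ST; exact: Su.
- move=> T hT A hA; have [[_ _ _ _ Acl] _] := hA; apply: Acl => eps /hT[S Su ST].
  by exists S => //; exact: Su.
Qed.

Section Construction.
Variables (R : realType) (d : nat) (u v : unitaries R d) (c : R).
Variables (e : nat -> uspace u)
  (Phi : forall n, bop (uspace v) (uspace v) -> 'M[R[i]]_n.+1).
Hypothesis e_orth : forall i j, i != j -> hdot (uspace u) (e i) (e j) = 0.
Hypothesis e_norm : forall i, e i = 0 \/ rnorm (e i) = 1.
Hypothesis e_total : forall h (eps : R), 0 < eps ->
  exists N, forall n, (N <= n)%N -> rnorm (h - proj e n h) <= eps.
Hypothesis Phi_cp : forall n, cpmap (@Phi n).
Hypothesis Phi1 : forall n, @Phi n (bid _) = 1%:M.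
Hypothesis PhiE : forall n i (k l : 'I_n.+1), e k != 0 ->
  c%:C * @Phi n (v i) l k = hdot (uspace u) (u i (e k)) (e l).
Variable U : set_system nat.
Hypotheses (UU : UltraFilter U) (Uoo : \oo `<=` U).

Local Notation Hu := (uspace u).
Local Notation Hv := (uspace v).
Local Notation B := (bop Hv Hv).
Local Notation st n := (stage (Phi_cp n)).
Local Notation word := (seq ('I_d * bool)).

Definition letter (a : 'I_d * bool) : B := if a.2 then v a.1 else adj (v a.1).
Definition wordop (w : word) : B := foldr (fun a T => bcomp (letter a) T) (bid Hv) w.

Lemma letter_isometry a x : rnorm (letter a x) = rnorm x.
Proof.
have iso (T : B) : bcomp (adj T) T = bid Hv -> rnorm (T x) = rnorm x.
  move=> TT; apply/eqP; rewrite -(@eqrXn2 _ 2) ?rnorm_ge0//; apply/eqP.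
  by apply: complexI; rewrite -!hdotxx -hdot_adjl -[adj T (T x)]/(bcomp (adj T) T x) TT.
have [h1 h2] := unitary_adj (uop_unitary v a.1).
by rewrite /letter; case: ifP => _; apply: iso; rewrite ?adjK.
Qed.

Lemma wordop_isometry w x : rnorm (wordop w x) = rnorm x.
Proof. by elim: w => //= a w IHw; rewrite letter_isometry. Qed.

(* The sequence of coordinates of the elementary tensor [S (x) x]. *)
Definition elem (S : B) (x : Hu) : nat -> B := fun k => hdot Hu x (e k) *: S.

Definition wordsum (s : seq (word * Hu)) : nat -> B :=
  \sum_(p <- s) elem (wordop p.1) p.2.

Lemma elemPl S (a : R[i]) x y : elem S (a *: x + y) = a *: elem S x + elem S y.
Proof. by apply/funext => k; rewrite /elem !fctE hsdE sdotP scalerDl -scalerA. Qed.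

Lemma elemZ S (a : R[i]) x : elem S (a *: x) = a *: elem S x.
Proof. by apply/funext => k; rewrite /elem !fctE hsdE sdotZl -scalerA. Qed.

Lemma elemB S x y : elem S (x - y) = elem S x - elem S y.
Proof. by rewrite addrC -scaleN1r elemPl scaleN1r addrC. Qed.

Lemma lmul_elem S T x : lmul S (elem T x) = elem (bcomp S T) x.
Proof. by apply/funext => k; rewrite /lmul /elem bcompZr. Qed.

Lemma stage_elem n (S : B) x y : st n (elem S x) (elem (bid Hv) y) =
  \sum_(k < n.+1) \sum_(l < n.+1)
    hdot Hu x (e k) * Num.conj (hdot Hu y (e l)) * Phi n S l k.
Proof.
rewrite stageE; apply: eq_bigr => k _; apply: eq_bigr => l _.
rewrite /elem adjZ adj_bid bcompZl bcompZr bcomp1l scalerA.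
by rewrite (linear_funZ _ _ (Phi_cp n).1) mxE [in RHS](mulrC (hdot _ _ _)).
Qed.

Lemma stage_elem1 n x y : st n (elem (bid Hv) x) (elem (bid Hv) y) =
  hdot Hu (proj e n.+1 x) y.
Proof.
rewrite stage_elem hdot_projl; apply: eq_bigr => k _.
rewrite Phi1 (bigD1 k)//= big1 ?addr0 => [|l lk].
  by rewrite mxE eqxx mulr1; congr (_ * _); rewrite !hsdE -sdotC.
by rewrite mxE (negbTE lk) mulr0.
Qed.

Lemma stage_elem_unitary n i x y : 
  c%:C * st n (elem (v i) x) (elem (bid Hv) y) =
  hdot Hu (u i (proj e n.+1 x)) (proj e n.+1 y).
Proof.
rewrite stage_elem {1}/proj (linear_sum (u i)) hsdE sdot_suml mulr_sumr.
apply: eq_bigr => k _; rewrite linearZZ sdotZl sdot_sumr !mulr_sumr.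
apply: eq_bigr => l _; rewrite sdotZr -hsdE.
have [ek|ek] := eqVneq (e k) 0.
  by rewrite ek hsdE sdot0r !mul0r mulr0.
by rewrite -PhiE//; ring.
Qed.

Lemma snorm_stage_elem n w x : snorm (st n) (elem (wordop w) x) <= rnorm x.
Proof.
have -> : elem (wordop w) x = lmul (wordop w) (elem (bid Hv) x).
  by rewrite lmul_elem bcomp1r.
rewrite (le_trans (snorm_stage_lmul _ _ ler01 _))// => [y|].
  by rewrite wordop_isometry mul1r.
rewrite mul1r -(@ler_pXn2r _ 2) ?nnegrE ?snorm_ge0 ?rnorm_ge0//.
rewrite snorm_sqr stage_elem1 (le_trans (Re_le_rnorm _))//.
rewrite (le_trans (hdot_CauchySchwarz _ _))// expr2 ler_wpM2r ?rnorm_ge0//.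
exact: rnorm_proj_le.
Qed.

(* The bound is uniform over all stages, so that approximability passes to the
   limit form and is inherited by left multiplication; the words in [v] give
   only countably many operators, whence separability. *)
Definition approximable (xi : nat -> B) := forall eps : R, 0 < eps ->
  exists s, forall n, snorm (st n) (xi - wordsum s) <= eps.

Lemma approximablePl (a : R[i]) xi eta :
  approximable xi -> approximable eta -> approximable (a *: xi + eta).
Proof.
move=> xa ea eps eps0; have e2 : 0 < eps / 2 by rewrite divr_gt0.
have a1 : 0 < rnorm a + 1 by rewrite ltr_wpDl ?rnorm_ge0.
have [s hs] := xa _ (divr_gt0 e2 a1); have [t ht] := ea _ e2.
exists (map (fun p => (p.1, a *: p.2)) s ++ t) => n.
rewrite /wordsum big_cat big_map /= -!/(wordsum _).
under eq_bigr do rewrite elemZ; rewrite -scaler_sumr -/(wordsum s).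
rewrite opprD addrACA -scalerBr (le_trans (snormD _ _ _))// (splitr eps) lerD//.
rewrite snormZ (le_trans (ler_wpM2l (rnorm_ge0 _) (hs n)))//.
by rewrite mulrCA ger_pMr// ler_pdivrMr// mul1r lerDl.
Qed.

Lemma approximable_wordsum s : approximable (wordsum s).
Proof. by move=> eps eps0; exists s => n; rewrite subrr snorm0 ltW. Qed.

Lemma approximable0 : approximable 0.
Proof. by have := approximable_wordsum [::]; rewrite /wordsum big_nil. Qed.

Lemma approximable_elem1 x : approximable (elem (bid Hv) x).
Proof. by have := approximable_wordsum [:: ([::], x)]; rewrite /wordsum big_seq1. Qed.

Lemma approximable_bounded xi : approximable xi ->
  exists M : R, forall n, snorm (st n) xi <= M.
Proof.
move=> /(_ 1 ltr01)[s hs]; exists (1 + \sum_(p <- s) rnorm p.2) => n.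
rewrite -(subrK (wordsum s) xi) (le_trans (snormD _ _ _))// lerD//.
rewrite (le_trans (snorm_sum _ _ _ _))//; apply: ler_sum => p _.
exact: snorm_stage_elem.
Qed.

Definition stable (S : B) := forall xi, approximable xi -> approximable (lmul S xi).

Lemma stablePl (a : R[i]) S T : stable S -> stable T -> stable (a *: S + T).
Proof.
move=> Ss Ts xi xa; have := approximablePl a (Ss _ xa) (Ts _ xa).
by congr approximable; apply/funext => k; exact: bop_eq.
Qed.

Lemma stable0 : stable 0.
Proof.
move=> xi _; have := approximable0; congr approximable; apply/funext => k.
exact: bop_eq.
Qed.

Lemma stable_bcomp S T : stable S -> stable T -> stable (bcomp S T).
Proof.
move=> Ss Ts xi xa; have := Ss _ (Ts _ xa); congr approximable.
by apply/funext => k; rewrite /lmul bcompA.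
Qed.

Lemma lmulB (S : B) (xi eta : nat -> B) : lmul S (xi - eta) = lmul S xi - lmul S eta.
Proof.
by apply/funext => k; apply: bop_eq => x; rewrite /lmul /= linearB.
Qed.

Lemma stable_letter a : stable (letter a).
Proof.
move=> xi xa eps /xa[s hs].
exists (map (fun p => (a :: p.1, p.2)) s) => n.
rewrite (_ : wordsum _ = lmul (letter a) (wordsum s)); last first.
  rewrite /wordsum big_map; elim: s {hs} => [|p s IHs].
    rewrite !big_nil; apply/funext => k; apply: bop_eq => x.
    by rewrite /lmul /= linear0.
  rewrite !big_cons IHs -lmul_elem; apply/funext => k; apply: bop_eq => x.
  by rewrite /lmul /= linearD.
rewrite -lmulB (le_trans (snorm_stage_lmul _ _ ler01 _)) ?mul1r//.
by move=> y; rewrite letter_isometry mul1r.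
Qed.

Lemma stable_closed S : (forall eps : R, 0 < eps ->
  exists2 T, stable T & (opnorm (S - T)%R < eps%:E)%E) -> stable S.
Proof.
move=> hS xi xa eps eps0; have [M xM] := approximable_bounded xa.
have e2 : 0 < eps / 2 by rewrite divr_gt0.
have M0 : 0 <= M by rewrite (le_trans _ (xM 0)) ?snorm_ge0.
have M1 : 0 < M + 1 by rewrite ltr_wpDl.
have [T Ts /opnorm_lt ST] := hS _ (divr_gt0 e2 M1).
have [s hs] := Ts _ xa _ e2; exists s => n.
rewrite (le_trans (snorm_dist _ _ _ (lmul T xi)))// (splitr eps) lerD//.
have -> : lmul S xi - lmul T xi = lmul (S - T) xi.
  by apply/funext => k; apply: bop_eq.
rewrite (le_trans (snorm_stage_lmul _ _ (ltW (divr_gt0 e2 M1)) ST))//.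
rewrite (le_trans (ler_wpM2l (ltW (divr_gt0 e2 M1)) (xM n)))//.
by rewrite -mulrA ger_pMr// mulrC ler_pdivrMr// mul1r lerDl.
Qed.

Definition bistable (S : B) := stable S /\ stable (adj S).

Lemma bistable_cstar_subalgebra : cstar_subalgebra [set S | bistable S].
Proof.
have Z (a : R[i]) S : stable S -> stable (a *: S).
  by move=> Ss; have := stablePl a Ss stable0; rewrite addr0.
have D S T : stable S -> stable T -> stable (S + T).
  by move=> Ss Ts; have := stablePl 1 Ss Ts; rewrite scale1r.
split=> /=.
- split; first by split; rewrite ?adj0; exact: stable0.
  by move=> S T [S1 S2] [T1 T2]; split; rewrite ?adjD; exact: D.
- by move=> a S [S1 S2]; split; rewrite ?adjZ; exact: Z.
- by move=> S T [S1 S2] [T1 T2]; split; rewrite ?adj_comp; exact: stable_bcomp.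
- by move=> S T [S1 S2] /is_adjointE ->; split; rewrite ?adjK.
- move=> T hT; split; apply: stable_closed => eps eps0.
    by have [S [S1 S2] ST] := hT _ eps0; exists S.
  have e2 : 0 < eps / 2 by rewrite divr_gt0.
  have [S [S1 S2] /opnorm_lt ST] := hT _ e2; exists (adj S) => //.
  rewrite -adjB; apply: (@le_lt_trans _ _ (eps / 2)%:E).
    by apply: opnorm_le (ltW e2) _; apply: adj_bounded (ltW e2).
  by rewrite lte_fin gtr_pMr// invf_lt1// ltr1n.
Qed.

Lemma bistable_bcomp S T : bistable S -> bistable T -> bistable (bcomp S T).
Proof. by have [_ _ M _ _] := bistable_cstar_subalgebra; exact: M. Qed.

Lemma bistable_letter i : bistable (v i).
Proof.
split; first exact: (stable_letter (i, true)).
exact: (stable_letter (i, false)).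
Qed.

Lemma cstar_generated_bistable S : @cstar_generated R d v S -> bistable S.
Proof.
apply; split; first exact: bistable_cstar_subalgebra.
by move=> _ [i _ <-]; exact: bistable_letter.
Qed.

Definition appx_pred : {pred (nat -> B) * Hv} := [pred x | `[< approximable x.1 >]].

Record appx := Appx { appx_val :> (nat -> B) * Hv; _ : appx_val \in appx_pred }.

HB.instance Definition _ := [isSub of appx for appx_val].
HB.instance Definition _ := [Choice of appx by <:].

Lemma appx_submod_closed : submod_closed appx_pred.
Proof.
split=> [|a x y]; first by apply/asboolP; exact: approximable0.
move=> /asboolP xa /asboolP ya; apply/asboolP; exact: approximablePl.
Qed.

HB.instance Definition _ :=
  GRing.isSubmodClosed.Build R[i] ((nat -> B) * Hv)%type appx_pred appx_submod_closed.
HB.instance Definition _ := [SubChoice_isSubLmodule of appx by <:].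

Lemma appxP (x : appx) : approximable (val x).1.
Proof. by case: x => x /= /asboolP. Qed.

Definition mkappx xi h (xa : approximable xi) : appx :=
  @Appx (xi, h) (asboolT xa).

Let bn n : semidot ((nat -> B) * Hv)%type := psd (st n) (hsd Hv).

Lemma appx_bounded (x : appx) : exists M : R, forall n, snorm (bn n) (\val x) <= M.
Proof.
have [M xM] := approximable_bounded (appxP x).
exists (M + rnorm (val x).2) => n.
by rewrite (le_trans (snorm_psd_le _ _ _))// snorm_hsd lerD2r.
Qed.

Definition form : semidot appx := usd UU appx_bounded.

Lemma formE x y : form x y =
  ulim U (fun n => st n (val x).1 (val y).1 + hdot Hv (val x).2 (val y).2).
Proof. by []. Qed.

(* Left multiplication, with junk value [0] when it does not act on [appx]. *)
Definition mulE (S : B) (x : appx) : appx :=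
  if pselect (stable S) is left Ss then mkappx (S (val x).2) (Ss _ (appxP x)) else 0.

Lemma val_mulE S x : stable S -> val (mulE S x) = (lmul S (val x).1, S (val x).2).
Proof. by rewrite /mulE; case: pselect. Qed.

Lemma mulE_linear S : linear (mulE S).
Proof.
move=> a x y; rewrite /mulE; case: pselect => [Ss|_]; last by rewrite scaler0 addr0.
apply: val_inj; congr pair; rewrite /= ?linearP//.
by apply/funext => k; apply: bop_eq => h; rewrite /lmul /= linearP.
Qed.

Lemma mulE_bounded (S : B) (M : R) x : 0 <= M -> (forall h, rnorm (S h) <= M * rnorm h) ->
  snorm form (mulE S x) <= M * snorm form x.
Proof.
move=> M0 SM; have [Ss|Sn] := pselect (stable S); last first.
  by rewrite /mulE; case: pselect => // _; rewrite snorm0 mulr_ge0 ?snorm_ge0.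
have xE : appx_val (mulE S x) = (lmul S (val x).1, S (val x).2) by exact: val_mulE.
apply: snorm_usd_leM => // n; apply: snorm_psd_leM => //=; rewrite xE /=.
  exact: snorm_stage_lmul.
by rewrite !snorm_hsd.
Qed.

Lemma mulE_adj S x y : bistable S -> form (mulE S x) y = form x (mulE (adj S) y).
Proof.
move=> [S1 S2]; rewrite !formE; congr ulim; apply/funext => n.
rewrite !val_mulE//; congr (_ + _); first exact: stage_adj.
exact/esym/hdot_adjr.
Qed.

Let K := antidual_hilbert form.

Definition bnd (S : B) : R := s2val (cid2 (bop_rbounded S)).

Lemma bnd_ge0 S : 0 <= bnd S.
Proof. by rewrite /bnd; case: cid2. Qed.

Lemma bndP (S : B) h : rnorm (S h) <= bnd S * rnorm h.
Proof. by rewrite /bnd; case: cid2. Qed.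

(* [f o mulE (adj S)] extends left multiplication by [S] to the completion. *)
Definition piK (S : B) : bop K K :=
  bop_precomp (mulE_linear (adj S)) (bnd_ge0 (adj S))
    (fun x => mulE_bounded x (bnd_ge0 (adj S)) (bndP (adj S))).

Lemma piKE S (f : K) x : (piK S f : antidual form) x = (f : antidual form) (mulE (adj S) x).
Proof. by []. Qed.

Lemma mulEPl (a : R[i]) S T x : stable S -> stable T ->
  mulE (a *: S + T) x = a *: mulE S x + mulE T x.
Proof.
move=> Ss Ts; apply: val_inj; rewrite val_mulE; last exact: stablePl.
rewrite [RHS](_ : _ = a *: val (mulE S x) + val (mulE T x))// !val_mulE//.
congr pair.
by apply/funext => k; exact: bop_eq.
Qed.

Lemma mulE_bcomp (S T : B) x : stable S -> stable T ->
  mulE (bcomp S T) x = mulE S (mulE T x).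
Proof.
move=> Ss Ts; apply: val_inj; rewrite !val_mulE//; last exact: stable_bcomp.
by congr pair; apply/funext => k; rewrite /lmul bcompA.
Qed.

Lemma stable_bid : stable (bid Hv).
Proof.
by move=> xi; congr approximable; apply/funext => k; rewrite /lmul bcomp1l.
Qed.

Lemma mulE_bid x : mulE (bid Hv) x = x.
Proof.
apply: val_inj; rewrite val_mulE; last exact: stable_bid.
case: x => -[xi h] /= _; congr pair.
by apply/funext => k; rewrite /lmul bcomp1l.
Qed.

Lemma piKPl (a : R[i]) S T : bistable S -> bistable T ->
  piK (a *: S + T) = a *: piK S + piK T.
Proof.
move=> [_ S2] [_ T2]; apply: bop_eq => f; apply: antidual_eq => x.
by rewrite piKE adjPl mulEPl// antidualP conjCK.
Qed.

Lemma piK_bcomp S T : bistable S -> bistable T ->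
  piK (bcomp S T) = bcomp (piK S) (piK T).
Proof.
move=> [_ S2] [_ T2]; apply: bop_eq => f; apply: antidual_eq => x.
by rewrite piKE adj_comp mulE_bcomp.
Qed.

Lemma piK_bid : piK (bid Hv) = bid K.
Proof.
by apply: bop_eq => f; apply: antidual_eq => x; rewrite piKE adj_bid mulE_bid.
Qed.

Lemma piK_adinj S x : bistable S -> piK S (adinj form x) = adinj form (mulE S x).
Proof.
by move=> Sb; apply: antidual_eq => y; exact/esym/mulE_adj.
Qed.

Lemma bistable_adj S : bistable S -> bistable (adj S).
Proof. by move=> [S1 S2]; split; rewrite ?adjK. Qed.

Lemma piK_adj S : bistable S -> adj (piK S) = piK (adj S).
Proof.
move=> Sb; apply: bop_eq => f; apply: antidual_eq => x.
by rewrite -hdot_antidual hdot_adjl piK_adinj// hdot_antidual piKE adjK.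
Qed.

Lemma piK_bounded (S : B) (M : R) : bistable S -> 0 <= M ->
  (forall h, rnorm (S h) <= M * rnorm h) -> forall f, rnorm (piK S f) <= M * rnorm f.
Proof.
move=> Sb M0 SM f; apply: dnorm_le => [|x]; first by rewrite mulr_ge0 ?rnorm_ge0.
rewrite piKE (le_trans (le_dnorm _ _))// -mulrA mulrCA ler_wpM2l ?dnorm_ge0//.
by apply: mulE_bounded => //; exact: adj_bounded.
Qed.

Lemma lamK_linear : linear (fun h => adinj form (mkappx h approximable0) : K).
Proof.
move=> a h k; rewrite -linearP; congr adinj; apply: val_inj.
by congr pair; rewrite /= scaler0 addr0.
Qed.

Lemma form_lamK h k :
  form (mkappx h approximable0) (mkappx k approximable0) = hdot Hv h k.
Proof.
rewrite formE -[RHS](ulim_cst UU Uoo); congr ulim; apply/funext => n.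
by rewrite [X in X + _](sdot0l (st n) 0) add0r.
Qed.

Lemma snorm_lamK h : snorm form (mkappx h approximable0) = rnorm h.
Proof. by rewrite -snorm_hsd /snorm form_lamK. Qed.

Lemma lamK_bounded : exists M : R, forall h,
  rnorm (adinj form (mkappx h approximable0) : K) <= M * rnorm h.
Proof. by exists 1 => h; rewrite mul1r -snorm_lamK -dnorm_adinj; exact: lexx. Qed.

Definition lamK : bop Hv K := mkbop lamK_linear lamK_bounded.

Lemma rnorm_lamK h : rnorm (lamK h) = rnorm h.
Proof. by rewrite -snorm_lamK -dnorm_adinj. Qed.

Lemma lamK_isometry h k : hdot K (lamK h) (lamK k) = hdot Hv h k.
Proof. by rewrite -form_lamK -[RHS]/(adinj form _ _) -hdot_antidual. Qed.

Lemma piK_lamK S h : bistable S -> piK S (lamK h) = lamK (S h).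
Proof.
move=> Sb; rewrite [lamK h]/(adinj form _) piK_adinj//; congr adinj; apply: val_inj.
rewrite val_mulE; last exact: Sb.1.
by congr pair; apply/funext => k; apply: bop_eq => x; rewrite /lmul /= linear0.
Qed.

Definition compK (T : bop K K) : B := bcomp (adj lamK) (bcomp T lamK).

Lemma compK_piK S : bistable S -> compK (piK S) = S.
Proof.
move=> Sb; apply: bop_eq => h.
have -> : compK (piK S) h = adj lamK (piK S (lamK h)) by [].
rewrite piK_lamK// -[LHS]/(bcomp (adj lamK) lamK (S h)) isometry_adj//.
exact: lamK_isometry.
Qed.

Lemma compKPl (a : R[i]) (S T : bop K K) : compK (a *: S + T) = a *: compK S + compK T.
Proof. by rewrite /compK bcompPl bcompPr. Qed.

Lemma compKB (S T : bop K K) : compK S - compK T = compK (S - T).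
Proof. by rewrite addrC -scaleN1r -compKPl scaleN1r addrC. Qed.

Lemma compK_adj T : adj (compK T) = compK (adj T).
Proof. by rewrite /compK !adj_comp adjK -bcompA. Qed.

Lemma compK_bounded (T : bop K K) (M : R) : (forall f, rnorm (T f) <= M * rnorm f) ->
  forall h, rnorm (compK T h) <= M * rnorm h.
Proof.
move=> TM h; have lam1 k : rnorm (lamK k) <= 1 * rnorm k by rewrite rnorm_lamK mul1r.
rewrite (le_trans (adj_bounded lam1 ler01 _))// mul1r (le_trans (TM _))//.
by rewrite rnorm_lamK.
Qed.

Lemma piK_unitary i : unitary_op (piK (v i)).
Proof.
have vb := bistable_letter i; have vb' := bistable_adj vb.
have [v1 v2] := unitary_adj (uop_unitary v i).
exists (piK (adj (v i))); split.
- by rewrite -piK_adj//; exact: adjP.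
- by rewrite -piK_bcomp// v1 piK_bid.
- by rewrite -piK_bcomp// v2 piK_bid.
Qed.

Lemma wordsum_approx (x : nat -> Hu) (s : seq (word * Hu)) :
  (forall h (eps : R), 0 < eps -> exists n, rnorm (h - x n) <= eps) ->
  forall eps : R, 0 < eps -> exists t : seq (word * nat), forall n,
    snorm (st n) (wordsum s - wordsum (map (fun p => (p.1, x p.2)) t)) <= eps.
Proof.
move=> xd; elim: s => [|[w h] s IHs] eps eps0.
  by exists [::] => n; rewrite /wordsum !big_nil subrr snorm0 ltW.
have e2 : 0 < eps / 2 by rewrite divr_gt0.
have [t ht] := IHs _ e2; have [m hm] := xd h _ e2.
exists ((w, m) :: t) => n; rewrite /wordsum /= !big_cons opprD addrACA.
rewrite (le_trans (snormD _ _ _))// (splitr eps) lerD//= -elemB.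
by rewrite (le_trans (snorm_stage_elem _ _ _)).
Qed.

Lemma K_separable : separable K.
Proof.
have [x xd] := separable_seq (uspace_separable u).
have [y yd] := separable_seq (uspace_separable v).
pose F (p : seq (word * nat) * nat) : K := adinj form
  (mkappx (y p.2) (approximable_wordsum (map (fun q => (q.1, x q.2)) p.1))).
apply: (@separable_range _ _ _ F) => f eps eps0.
have e4 : 0 < eps / 4 by rewrite divr_gt0.
have [z fz] := adinj_dense f e4.
have [s hs] := appxP z e4; have [t ht] := wordsum_approx s xd e4.
have [m hm] := yd (val z).2 _ e4.
pose w : appx := mkappx (y m) (approximable_wordsum (map (fun q => (q.1, x q.2)) t)).
have zw : snorm form (z - w) <= eps / 4 + eps / 4 + eps / 4.
  apply: (snorm_usd_le UU Uoo) => [|n]; first by lra.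
  rewrite (le_trans (snorm_psd_le _ _ _))// lerD//; last by rewrite snorm_hsd.
  by rewrite (le_trans (snorm_dist _ _ _ (wordsum s)))// lerD.
exists (t, m); apply: (le_trans (rnorm_dist _ _ (adinj form z : K))).
apply: le_trans (_ : eps / 4 + (eps / 4 + eps / 4 + eps / 4) <= eps); last by lra.
apply: lerD => //; rewrite -[F _]/(adinj form w).
by apply: le_trans zw; rewrite -dnorm_adinj linearB; exact: lexx.
Qed.

Definition japp x : appx := mkappx 0 (approximable_elem1 x).

Lemma jK_linear : linear (fun x => adinj form (japp x) : K).
Proof.
move=> a x y; rewrite -linearP; congr adinj; apply: val_inj.
by congr pair; rewrite /= ?elemPl// scaler0 addr0.
Qed.

Lemma form_japp x y : form (japp x) (japp y) = hdot Hu x y.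
Proof.
rewrite formE; apply: (ulim_cvg UU Uoo) => eps eps0.
have y1 : 0 < rnorm y + 1 by rewrite ltr_wpDl ?rnorm_ge0.
have [N hN] := e_total x (divr_gt0 eps0 y1); exists N => n Nn.
rewrite (_ : _ + hdot Hv _ _ = hdot Hu (proj e n.+1 x) y); last first.
  by rewrite [X in _ + X](sdot0l (hsd Hv) 0) addr0; exact: stage_elem1.
rewrite !hsdE -sdotBl (le_trans (hdot_CauchySchwarz _ _))// rnorm_distC.
rewrite (le_trans (ler_wpM2r (rnorm_ge0 _) (hN _ (leqW Nn))))//.
by rewrite -mulrA ger_pMr// mulrC ler_pdivrMr// mul1r lerDl.
Qed.

Lemma jK_bounded : exists M : R, forall x,
  rnorm (adinj form (japp x) : K) <= M * rnorm x.
Proof.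
exists 1 => x.
have -> : rnorm x = snorm form (japp x) by rewrite -snorm_hsd /snorm form_japp.
by rewrite mul1r -dnorm_adinj; exact: lexx.
Qed.

Definition jK : bop Hu K := mkbop jK_linear jK_bounded.

Lemma jK_isometry x y : hdot K (jK x) (jK y) = hdot Hu x y.
Proof. by rewrite -form_japp -[RHS]/(adinj form _ _) -hdot_antidual. Qed.

Lemma form_dilation i x y :
  c%:C * form (mulE (v i) (japp x)) (japp y) = hdot Hu (u i x) y.
Proof.
have vs := (bistable_letter i).1.
have [M M0 uM] := bop_rbounded (u i).
have limE : c%:C * form (mulE (v i) (japp x)) (japp y) =
    ulim U (fun n => hdot Hu (u i (proj e n.+1 x)) (proj e n.+1 y)).
  have b0 := bounded_seq_cst (0 : R[i]).
  have := ulimPl UU (c%:C)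
    (bounded_seq_sdot appx_bounded (mulE (v i) (japp x)) (japp y)) b0.
  rewrite (ulim_cst UU Uoo) addr0 => <-; congr ulim; apply/funext => n.
  rewrite addr0 -stage_elem_unitary; congr (_ * _).
  rewrite psdE [X in _ + X](sdot0r (hsd Hv)) addr0; congr (stage _ _ _).
  rewrite [LHS](_ : _ = (val (mulE (v i) (japp x))).1)// val_mulE//=.
  by rewrite lmul_elem bcomp1r.
rewrite limE; apply: (ulim_cvg UU Uoo) => eps eps0.
pose C := M * rnorm y + M * rnorm x.
have C1 : 0 < C + 1 by rewrite ltr_wpDl// addr_ge0// mulr_ge0 ?rnorm_ge0.
have [N1 h1] := e_total x (divr_gt0 eps0 C1).
have [N2 h2] := e_total y (divr_gt0 eps0 C1).
exists (maxn N1 N2) => n; rewrite geq_max => /andP[/leqW/h1 hx /leqW/h2 hy].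
move: hx hy; set px := proj e n.+1 x; set py := proj e n.+1 y => hx hy.
have -> : hdot Hu (u i px) py - hdot Hu (u i x) y =
    - (hdot Hu (u i (x - px)) py + hdot Hu (u i x) (y - py)).
  rewrite (linearB (u i)) !hsdE sdotBl sdotBr; ring.
have C0 : C * (eps / (C + 1)) <= eps.
  by rewrite mulrCA ger_pMr// ler_pdivrMr// mul1r lerDl.
rewrite rnormN (le_trans (rnormD _ _))// (le_trans _ C0)// mulrDl lerD//.
  rewrite (le_trans (hdot_CauchySchwarz _ _))// mulrAC ler_pM ?rnorm_ge0//.
    by rewrite (le_trans (uM _))// ler_wpM2l.
  exact: rnorm_proj_le.
by rewrite (le_trans (hdot_CauchySchwarz _ _))// ler_pM ?rnorm_ge0.
Qed.

Definition VK : unitaries R d := Unitaries K_separable piK_unitary.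

Lemma piKZ (a : R[i]) S : bistable S -> piK (a *: S) = a *: piK S.
Proof.
move=> [_ S2]; apply: bop_eq => f; apply: antidual_eq => x.
rewrite piKE adjZ -[_ *: adj S]addr0 mulEPl//; last exact: stable0.
rewrite antidualP conjCK -[X in _ + X](_ : 0 = _) ?addr0//.
rewrite (_ : mulE 0 x = 0) ?antidual0//; apply: val_inj.
rewrite val_mulE; last exact: stable0.
by congr pair; apply/funext => k; exact: bop_eq.
Qed.

Lemma piK0 : piK 0 = 0.
Proof.
have [[b0 _] _ _ _ _] := bistable_cstar_subalgebra.
by rewrite -(scale0r (0 : B)) piKZ// scale0r.
Qed.

Lemma bistableB S T : bistable S -> bistable T -> bistable (S - T).
Proof.
have [[_ D] Z _ _ _] := bistable_cstar_subalgebra.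
by move=> Sb Tb; apply: D => //; rewrite -scaleN1r; exact: Z.
Qed.

Lemma piKB S T : bistable S -> bistable T -> piK (S - T) = piK S - piK T.
Proof.
by move=> Sb Tb; rewrite addrC -scaleN1r piKPl// scaleN1r addrC.
Qed.

Lemma piK_cstar S : @cstar_generated R d v S -> @cstar_generated R d VK (piK S).
Proof.
have bg := bistable_cstar_subalgebra; have [[b0 bD] bZ bM bA bC] := bg.
have [[g0 gD] gZ gM gA gC] := cstar_generated_subalgebra VK.
move: S; suff h : @cstar_generated R d v `<=`
    [set S | bistable S /\ @cstar_generated R d VK (piK S)].
  by move=> S /h[].
apply: smallest_sub; last first.
  move=> _ [i _ <-]; split; first exact: bistable_letter.
  by apply: (sub_gen_smallest); exists i.
split.
- split; first by split=> //; rewrite piK0.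
  move=> S T [Sb SV] [Tb TV]; split; first exact: bD.
  by rewrite -[S]scale1r piKPl// scale1r; exact: gD.
- by move=> a S [Sb SV]; split; [exact: bZ|rewrite piKZ//; exact: gZ].
- by move=> S T [Sb SV] [Tb TV]; split; [exact: bM|rewrite piK_bcomp//; exact: gM].
- move=> S T [Sb SV] ST; split; first exact: bA ST.
  by apply: gA SV _; rewrite (is_adjointE ST) -piK_adj//; exact: adjP.
- move=> T hT; have Tb : bistable T.
    by apply: bC => eps /hT[S [Sb _] ST]; exists S.
  split=> //; apply: gC => eps eps0; have e2 : 0 < eps / 2 by rewrite divr_gt0.
  have [S [Sb SV] /opnorm_lt ST] := hT _ e2; exists (piK S) => //.
  rewrite -piKB//; apply: (@le_lt_trans _ _ (eps / 2)%:E).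
    apply: opnorm_le (ltW e2) _; apply: piK_bounded (ltW e2) ST.
    exact: bistableB.
  by rewrite lte_fin gtr_pMr// invf_lt1// ltr1n.
Qed.

(* [compK] inverts [piK] and is norm-decreasing, so the image of the C*-algebra
   of [v] under [piK] is closed without using completeness of [bop K K]. *)
Lemma cstar_generated_VK T :
  @cstar_generated R d VK T -> exists2 S, @cstar_generated R d v S & T = piK S.
Proof.
have [[g0 gD] gZ gM gA gC] := cstar_generated_subalgebra v.
have gb := cstar_generated_bistable.
move: T; suff h : @cstar_generated R d VK `<=`
    [set T | exists2 S, @cstar_generated R d v S & T = piK S] by move=> T /h.
apply: smallest_sub; last first.
  by move=> _ [i _ <-]; exists (v i) => //; apply: (sub_gen_smallest); exists i.
split.
- split; first by exists 0; rewrite ?piK0.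
  move=> _ _ [S Sv ->] [T Tv ->]; exists (S + T); first exact: gD.
  by rewrite -[S in RHS]scale1r piKPl ?scale1r//; exact: gb.
- by move=> a _ [S Sv ->]; exists (a *: S); [exact: gZ|rewrite piKZ//; exact: gb].
- move=> _ _ [S Sv ->] [T Tv ->]; exists (bcomp S T); first exact: gM.
  by rewrite piK_bcomp//; exact: gb.
- move=> _ T [S Sv ->] /is_adjointE ->; exists (adj S).
    by apply: gA Sv _; exact: adjP.
  by rewrite piK_adj//; exact: gb.
- move=> T hT.
  have near (eps : R) : 0 < eps -> exists2 S, @cstar_generated R d v S &
      (forall f, rnorm ((T - piK S) f) <= eps * rnorm f) /\
      (forall x, rnorm ((compK T - S) x) <= eps * rnorm x).
    move=> eps0; have [_ [S Sv ->] /opnorm_lt ST] := hT _ eps0; exists S => //.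
    split=> //; rewrite -{1}(compK_piK (gb _ Sv)).
    by rewrite compKB; exact: compK_bounded.
  have cTv : @cstar_generated R d v (compK T).
    apply: gC => eps eps0; have e2 : 0 < eps / 2 by rewrite divr_gt0.
    have [S Sv [_ ST]] := near _ e2; exists S => //.
    apply: (@le_lt_trans _ _ (eps / 2)%:E); first exact: opnorm_le (ltW e2) ST.
    by rewrite lte_fin gtr_pMr// invf_lt1// ltr1n.
  exists (compK T) => //; apply: bop_eq => f; apply/eqP; rewrite -subr_eq0; apply/eqP.
  apply: (@rnorm_eps _ _ _ (rnorm f + rnorm f)) => eps eps0.
  have [S Sv [ST ST']] := near _ eps0.
  rewrite (le_trans (rnorm_dist _ _ (piK S f)))// mulrDl lerD//.
    by rewrite mulrC; exact: ST.
  rewrite rnorm_distC mulrC -bopB -piKB; try exact: gb.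
  by apply: piK_bounded (ltW eps0) ST' f; apply: bistableB; exact: gb.
Qed.

Lemma uequiv_VK : uequiv VK v.
Proof.
have gb := cstar_generated_bistable.
exists compK; split.
- split.
  + by move=> _ /cstar_generated_VK[S Sv ->]; rewrite compK_piK//; exact: gb.
  + move=> S T; rewrite !inE => /cstar_generated_VK[S' Sv ->].
    move=> /cstar_generated_VK[T' Tv ->].
    by rewrite !compK_piK; try exact: gb; move=> ->.
  + move=> S Sv; exists (piK S); first exact: piK_cstar.
    by rewrite compK_piK//; exact: gb.
- split; first by move=> S T _ _; rewrite -{1}[S]scale1r compKPl scale1r.
  by move=> a S _; rewrite /compK bcompZl bcompZr.
- move=> S T; rewrite !inE => /cstar_generated_VK[S' Sv ->].
  move=> /cstar_generated_VK[T' Tv ->].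
  by rewrite -piK_bcomp ?compK_piK//; try exact: gb; apply: bistable_bcomp; exact: gb.
- move=> S _ T /is_adjointE ->; rewrite -compK_adj; exact: adjP.
- by move=> i; rewrite compK_piK//; exact: bistable_letter.
Qed.

Lemma uequiv_refl (w : unitaries R d) : uequiv w w.
Proof.
exists id; split=> //; split=> // S Sw; last by exists S.
Qed.

Lemma dilates_of_ucp : dilates c u v.
Proof.
exists u, VK; split; [exact: uequiv_refl|exact: uequiv_VK|].
exists jK, (bcomp jK (adj jK)); split.
- exact: jK_isometry.
- exact: isometry_projection jK_isometry.
- move=> i x; congr (jK _); apply: hdot_inj => y.
  rewrite hdot_adjl -form_dilation.
  rewrite [RHS](sdotZl (hsd K) c%:C (piK (v i) (jK x)) (jK y)); congr (_ * _).
  rewrite [jK x]/(adinj form (japp x)) piK_adinj; last exact: bistable_letter.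
  exact/esym/hdot_antidual.
Qed.

End Construction.
Section FinalBound.
Variable R : realType.
Local Open Scope sesquilinear_scope.

Lemma cpmap_state_diag (H : hilbertType R) n (f : bop H H -> 'M[R[i]]_1)
    (P : pred 'I_n) : cpmap f ->
  cpmap (fun T => \sum_(k < n | P k) f T 0 0 *:
    ((delta_mx k 0 : 'cV[R[i]]_n) *m (delta_mx k 0)^t*)).
Proof. by move=> fc; apply: cpmap_sum => k _; exact: cpmap_rank1. Qed.

Lemma state_diagE (a : R[i]) n (P : pred 'I_n) (l m : 'I_n) :
  (\sum_(k < n | P k) a *: ((delta_mx k 0 : 'cV[R[i]]_n) *m (delta_mx k 0)^t*)) l m
  = if (l == m) && P m then a else 0.
Proof.
rewrite summxE; have [Pm|Pm] := boolP (P m); last first.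
  rewrite andbF big1// => k Pk; rewrite !mxE big_ord1 !mxE eqxx andbT.
  have [mk|_] := eqVneq m k; first by rewrite mk Pk in Pm.
  by rewrite conjC0 !mulr0.
rewrite andbT (bigD1 m)//= big1 ?addr0 => [|k /andP[_ km]].
  rewrite !mxE big_ord1 !mxE !eqxx !andbT conjC1 mulr1.
  by case: eqP; rewrite ?mulr1 ?mulr0.
rewrite !mxE big_ord1 !mxE eqxx !andbT [m == k]eq_sym (negbTE km).
by rewrite conjC0 !mulr0.
Qed.

Lemma Udelta_state d (delta : R) (u : unitaries R d) : 0 < delta -> Udelta delta u ->
  exists f : bop (uspace u) (uspace u) -> 'M[R[i]]_1, cpmap f /\ f (bid _) = 1%:M.
Proof.
move=> d0 /(_ 0); rewrite l2normE snorm0 => /(_ d0) /matrix_rangeP[f [fc f1 _]].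
by exists f.
Qed.

Lemma matrix_range_neq0 d (delta : R) (u : unitaries R d) n :
  0 < delta -> Udelta delta u -> exists X, @matrix_range R n d u X.
Proof.
move=> d0 /(Udelta_state d0)[f [fc f1]].
pose g T := \sum_(k < n) f T 0 0 *: ((delta_mx k 0 : 'cV[R[i]]_n) *m (delta_mx k 0)^t*).
exists (fun i => g (u i)); apply/matrix_rangeP; exists g; split=> //.
  exact: (cpmap_state_diag xpredT fc).
apply/matrixP => l m; rewrite /g (state_diagE _ xpredT) f1 !mxE eqxx andbT.
by case: eqP.
Qed.

Lemma dilates_scaled d (delta r r' : R) (u v : unitaries R d) :
  0 < delta -> 0 <= r' < r -> Udelta delta u -> Udelta delta v ->
  (forall n X, (0 < n)%N -> @matrix_range R n d u X ->
    exists2 Y, @matrix_range R n d v Y & forall i z,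
      snorm (csd R n) ((X i - Y i) *m z) <= r' * snorm (csd R n) z) ->
  dilates (1 + d%:R * r / delta) u v.
Proof.
move=> d0 r'r hu hv hW; set c := 1 + _.
have c0 : 0 < c.
  have /andP[r'0 r'r'] := r'r.
  by rewrite ltr_pwDl// divr_ge0 ?(ltW d0)// mulr_ge0// (le_trans r'0)// ltW.
have [e [e_orth e_norm e_total]] := orthonormal_seq (uspace_separable u).
have [f [fc f1]] := Udelta_state d0 hu.
(* The state [f] fills the diagonal entries where [e k = 0], so that the
   compression becomes unital. *)
pose phi n (T : bop (uspace u) (uspace u)) : 'M[R[i]]_n.+1 :=
  (\matrix_(l, k) hdot (uspace u) (T (e k)) (e l)) +
  \sum_(k < n.+1 | e k == 0) f T 0 0 *:
    ((delta_mx k 0 : 'cV[R[i]]_n.+1) *m (delta_mx k 0)^t*).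
have phic n : cpmap (phi n).
  apply: cpmapD; first exact: (cpmap_compression (fun k : 'I_n.+1 => e k)).
  exact: (cpmap_state_diag (fun k : 'I_n.+1 => e k == 0) fc).
have phi1 n : phi n (bid _) = 1%:M.
  apply/matrixP => l m; rewrite mxE (state_diagE _ (fun k : 'I_n.+1 => e k == 0)).
  rewrite f1 !mxE eqxx; have [->|lm] := eqVneq l m.
    have [->|em1] := e_norm m; first by rewrite eqxx /= hsdE sdot0l add0r.
    rewrite /= hdotxx em1 expr1n; case: eqP => [em|_]; last by rewrite addr0.
    by move: em1; rewrite em rnorm0 => /eqP; rewrite eq_sym oner_eq0.
  by rewrite /= e_orth ?addr0// eq_sym.
have Phi_ex n : exists g : bop (uspace v) (uspace v) -> 'M[R[i]]_n.+1,
    [/\ cpmap g, g (bid _) = 1%:M & forall i, phi n (u i) = c%:C *: g (v i)].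
  have [|Y vY XY] := hW n.+1 (fun i => phi n (u i)) isT.
    by apply/matrix_rangeP; exists (phi n).
  by have [g [gc g1 gE]] := matrix_range_scaled d0 r'r hv vY XY; exists g.
pose Phi n := sval (cid (Phi_ex n)).
have PhiP n := svalP (cid (Phi_ex n)).
have [U [UU Uoo]] := ultraFilterLemma (eventually_filter : ProperFilter \oo).
have Phic n : cpmap (Phi n) by have [] := PhiP n.
apply: (dilates_of_ucp e_orth e_norm e_total Phic _ _ UU Uoo).
  by move=> n; have [] := PhiP n.
move=> n i k l ek; have [_ _ h] := PhiP n.
have := congr1 (fun M : 'M[R[i]]_n.+1 => M l k) (h i).
rewrite mxE (state_diagE _ (fun k : 'I_n.+1 => e k == 0)) (negbTE ek) andbF addr0.
by rewrite !mxE => <-.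
Qed.

Lemma mxtuple_dist_ge0 n d (X Y : 'I_d -> 'M[R[i]]_n) : (0 <= mxtuple_dist X Y)%E.
Proof. exact: bigmax_ge_id. Qed.

Lemma dmr_ge0 d (delta : R) (u v : unitaries R d) : 0 < delta -> Udelta delta u ->
  (0 <= dmr u v)%E.
Proof.
move=> d0 hu; have [X uX] := matrix_range_neq0 1 d0 hu.
apply: (@le_trans _ _ (hausdorff_dist (@mxtuple_dist R 1 d)
   (@matrix_range R 1 d u) (@matrix_range R 1 d v))); last first.
  by apply: ereal_sup_ubound; exists 1%N.
rewrite /hausdorff_dist le_max; apply/orP; left.
apply: le_trans (ereal_sup_ubound _); last by exists X; first exact: uX.
by apply: le_ereal_inf_tmp => _ [Y _ <-]; exact: mxtuple_dist_ge0.
Qed.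

Lemma mxtuple_dist_lt n d (X Y : 'I_d -> 'M[R[i]]_n) (r : R) :
  (mxtuple_dist X Y < r%:E)%E -> forall i z,
  snorm (csd R n) ((X i - Y i) *m z) <= r * snorm (csd R n) z.
Proof.
move=> XYr i; apply: mxopnorm_lt; apply: le_lt_trans XYr.
exact: (le_bigmax _ (fun i => mxopnorm (X i - Y i))).
Qed.

Lemma dilates_dmr d (delta r r' : R) (u v : unitaries R d) :
  0 < delta -> 0 <= r' < r -> Udelta delta u -> Udelta delta v ->
  (dmr u v < r'%:E)%E ->
  dilates (1 + d%:R * r / delta) u v /\ dilates (1 + d%:R * r / delta) v u.
Proof.
move=> d0 r'r hu hv uvr.
have W n : (0 < n)%N -> (hausdorff_dist (@mxtuple_dist R n d)
    (@matrix_range R n d u) (@matrix_range R n d v) < r'%:E)%E.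
  by move=> n0; apply: le_lt_trans uvr; apply: ereal_sup_ubound; exists n.
split; apply: (dilates_scaled d0 r'r) => // n X n0 uX.
  have := W n n0; rewrite /hausdorff_dist gt_max => /andP[h _].
  have : (ereal_inf [set mxtuple_dist X y | y in @matrix_range R n d v] < r'%:E)%E.
    by apply: le_lt_trans h; apply: ereal_sup_ubound; exists X.
  by move=> /ereal_inf_lt[_ [Y vY <-]] XY; exists Y => //; exact: mxtuple_dist_lt.
have := W n n0; rewrite /hausdorff_dist gt_max => /andP[_ h].
have : (ereal_inf [set mxtuple_dist x X | x in @matrix_range R n d u] < r'%:E)%E.
  by apply: le_lt_trans h; apply: ereal_sup_ubound; exists X.
move=> /ereal_inf_lt[_ [Y vY <-]] XY; exists Y => // i z.
by rewrite -snormN -mulNmx opprB; exact: mxtuple_dist_lt.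
Qed.

Lemma dilation_constant_ge0 d (u v : unitaries R d) : (0 <= dilation_constant u v)%E.
Proof. by apply: le_ereal_inf_tmp => _ [c [c0 _] <-]; rewrite lee_fin ltW. Qed.

Lemma dilation_constant_le d (u v : unitaries R d) (c : R) : 0 < c ->
  dilates c u v -> (dilation_constant u v <= c%:E)%E.
Proof. by move=> c0 cuv; apply: ereal_inf_lbound; exists c. Qed.

Lemma dD_le_dilates d (x : R) (u v : unitaries R d) : 0 <= x ->
  dilates (1 + x) u v -> dilates (1 + x) v u -> (dD u v <= x%:E)%E.
Proof.
move=> x0 duv dvu; have c0 : 0 < 1 + x by rewrite ltr_pwDl.
rewrite /dD (@le_trans _ _ (lne (1 + x)%:E))//.
  rewrite lee_lne ?ge_max ?dilation_constant_le//.
    by rewrite in_itv /= leey andbT le_max dilation_constant_ge0.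
  by rewrite in_itv /= leey andbT lee_fin ltW.
by rewrite EFinD le_lne1Dx// -EFinN lee_fin (le_trans _ x0)// lerN10.
Qed.

Lemma dD_le d (delta r : R) (u v : unitaries R d) : 0 < delta ->
  Udelta delta u -> Udelta delta v -> (dmr u v < r%:E)%E ->
  (dD u v <= (d%:R * r / delta)%:E)%E.
Proof.
move=> d0 hu hv uvr.
have : exists r', (dmr u v < r'%:E)%E /\ 0 <= r' < r.
  have := dmr_ge0 v d0 hu; move: uvr; case: (dmr u v) => [t| |]//.
  rewrite lte_fin lee_fin => tr t0; exists ((t + r) / 2).
  by rewrite lte_fin; split; lra.
move=> [r' [uvr' r'r]].
have [duv dvu] := dilates_dmr d0 r'r hu hv uvr'.
apply: dD_le_dilates => //; have /andP[r'0 r'r'] := r'r.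
by rewrite divr_ge0 ?(ltW d0)// mulr_ge0// (le_trans r'0)// ltW.
Qed.

(* The case [d = 0] is separate because of the convention [0 * +oo = 0]. *)
Lemma dD_le0 (delta : R) (u v : unitaries R 0) : 0 < delta ->
  Udelta delta u -> Udelta delta v -> (dD u v <= 0)%E.
Proof.
move=> d0 hu hv; have r01 : 0 <= (0 : R) < 1 by rewrite lexx ltr01.
have dil (w w' : unitaries R 0) : Udelta delta w -> Udelta delta w' ->
    dilates (1 + 0) w w'.
  move=> hw hw'; rewrite -[X in 1 + X](mul0r (1 / delta)) mulrA.
  apply: (dilates_scaled d0 r01 hw hw') => n X n0 _.
  by have [Y] := matrix_range_neq0 n d0 hw'; exists Y => // -[].
by apply: dD_le_dilates => //; exact: dil.
Qed.

End FinalBound.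

Theorem proposition2p4 (R : realType) (d : nat) (delta : R)
  (delta_gt0 : 0 < delta) (u v : unitaries R d)
  (hu : Udelta delta u) (hv : Udelta delta v) :
  (dD u v <= (d%:R * delta^-1)%:E * dmr u v)%E.
Proof.
have := dmr_ge0 v delta_gt0 hu; have := dD_le delta_gt0 hu hv.
case: (dmr u v) => [t| |] // h t0.
  apply/lee_addgt0Pr => eps eps0.
  have d1 : 0 < d%:R + 1 :> R by rewrite ltr_wpDl.
  pose s := eps * delta / (d%:R + 1).
  have s0 : 0 < s by rewrite divr_gt0 ?mulr_gt0.
  apply: le_trans (h (t + s) _) _; first by rewrite lte_fin ltrDl.
  rewrite -EFinM -EFinD lee_fin mulrDr mulrDl [d%:R * t / _]mulrAC lerD2l /s.
  have -> : d%:R * (eps * delta / (d%:R + 1)) / delta = eps * (d%:R / (d%:R + 1)).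
    by field; rewrite !gt_eqF.
  by rewrite ger_pMr// ler_pdivrMr// mul1r lerDl.
case: d u v hu hv {h} => [|d] u v hu hv.
  by rewrite mul0r mul0e; exact: dD_le0 hu hv.
by rewrite gt0_muley ?leey// lte_fin mulr_gt0 ?ltr0n ?invr_gt0.
Qed.
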